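(* Let $k$ be a commutative ring and let $(E,R)$ be a finite poset. Let $T$ be a finite lattice such that $\mathrm{Irr}(T)=(E,R)$ and such that the restriction homomorphism $\mathrm{Aut}(T)\to\mathrm{Aut}(E,R)$ is an isomorphism. For every finite set $X$, the evaluation $\mathbb{S}_{E,R^{op}}(X)$ of the fundamental functor $\mathbb{S}_{E,R^{op}}$ is a free right $k\mathrm{Aut}(E,R)$-module.
   Context: **Lattices.** In a finite lattice $T$, an element $e$ is irreducible if $e=\bigvee_{a\in A}a$ with $A\subseteq T$ implies $e\in A$ (so $\hat0$ is not irreducible). $\mathrm{Irr}(T)=(E,R)$ denotes the set $E$ of irreducible elements with the order $R$ induced from $T$; $R^{op}$ is the opposite order. $\mathrm{Aut}(E,R)=\mathrm{Aut}(E,R^{op})$ is the group of poset automorphisms; $\mathrm{Aut}(T)$ is the group of lattice automorphisms. **Correspondences.** For finite sets $X,Y$, $\mathcal{C}(Y,X)$ is the set of all subsets of $Y\times X$; composition of $S\subseteq Z\times Y$ and $Q\subseteq Y\times X$ is $SQ=\{(z,x)\mid\exists y\in Y,\ (z,y)\in S,\ (y,x)\in Q\}$. $k\mathcal{C}(Y,X)$ is the free $k$-module on $\mathcal{C}(Y,X)$, with bilinear composition; $k\mathcal{C}(E,E)$ is a $k$-algebra. $\Delta_E=\{(e,e)\mid e\in E\}$ and, for a permutation $\alpha$ of $E$, $\Delta_\alpha=\{(\alpha(e),e)\mid e\in E\}$. **Fundamental functors.** For a finite poset $(E,R)$, the fundamental module $\mathcal{P}_Ef_R$ is the left $k\mathcal{C}(E,E)$-module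 which is $k$-free with basis $\{\Delta_\alpha f_R\}$, $\alpha$ running over the permutations of $E$ ($f_R:=\Delta_{\mathrm{id}}f_R$), where a relation $Q\in\mathcal{C}(E,E)$ acts by $Q\cdot\Delta_\alpha f_R=\Delta_{\beta\alpha}f_R$ if there is a (necessarily unique) permutation $\beta$ with $\Delta_E\subseteq\Delta_{\beta^{-1}}Q\subseteq{}^{\alpha}R:=\{(\alpha(e),\alpha(f))\mid(e,f)\in R\}$, and $Q\cdot\Delta_\alpha f_R=0$ otherwise. It is a bimodule with right action of $\tau\in\mathrm{Aut}(E,R)$ given by $\Delta_\alpha f_R\cdot\tau=\Delta_{\alpha\tau}f_R$. For a left $k\mathcal{C}(E,E)$-module $W$, $L_{E,W}(X)=k\mathcal{C}(X,E)\otimes_{k\mathcal{C}(E,E)}W$ and $J_{E,W}(X)=\{\sum_i\varphi_i\otimes w_i\mid\forall\rho\in k\mathcal{C}(E,X),\ \sum_i(\rho\varphi_i)\cdot w_i=0\}$. The fundamental functor is $\mathbb{S}_{E,R}=L_{E,\mathcal{P}_Ef_R}/J_{E,\mathcal{P}_Ef_R}$; the right action of $k\mathrm{Aut}(E,R)$ on $\mathcal{P}_Ef_R$ induces a right action on $L_{E,\mathcal{P}_Ef_R}(X)$ which preserves $J_{E,\mathcal{P}_Ef_R}(X)$, hence a right $k\mathrm{Aut}(E,R)$-module structure on $\mathbb{S}_{E,R}(X)$. The same applies with $R^{op}$ in place of $R$. *)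

(* Defs.v *)
From HB Require Import structures.
From mathcomp Require Import all_boot all_order all_algebra all_fingroup.
From mathcomp Require Import boolp.
From mathcomp.multinomials Require Import freeg.

Set Implicit Arguments.
Unset Strict Implicit.
Unset Printing Implicit Defensive.

Import Order.TTheory GRing.Theory.

Local Open Scope ring_scope.
Local Open Scope quotient_scope.

(* Throughout, a right B-module is a left module over the converse ring B^c.  *)
(* Bases need not be finite: sums are taken over finite sequences of indices. *)

Definition is_basis (B : pzRingType) (M : lmodType B) (I : choiceType)
    (b : I -> M) : Prop :=
  (forall m : M, exists (s : seq I) (c : I -> B),
     m = \sum_(i <- s) c i *: b i) /\
  (forall (s : seq I) (c : I -> B), uniq s ->
     \sum_(i <- s) c i *: b i = 0 -> forall i, i \in s -> c i = 0).

Definition free_module (B : pzRingType) (M : lmodType B) : Prop :=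
  exists (I : choiceType) (b : I -> M), is_basis b.

(* The free k-module with basis a finite set C is {ffun C -> k}; [delta k c]  *)
(* is the basis element c, and [bilin op] is the bilinear map whose values on *)
(* pairs of basis elements are given by op.                                   *)

Definition delta (k : comPzRingType) (C : finType) (c : C) : {ffun C -> k} :=
  [ffun d => (d == c)%:R].

Section Bilinear.
Variable k : comPzRingType.

Definition bilin (A B C : finType) (op : A -> B -> {ffun C -> k})
    (x : {ffun A -> k}) (y : {ffun B -> k}) : {ffun C -> k} :=
  [ffun c => \sum_a \sum_b x a * y b * op a b c].

Lemma bilinDl (A B C : finType) (op : A -> B -> {ffun C -> k}) :
  forall x x' y, bilin op (x + x') y = bilin op x y + bilin op x' y.
Proof.
move=> x x' y; apply/ffunP=> c; rewrite !ffunE -big_split /=.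
apply: eq_bigr => a _; rewrite -big_split /=; apply: eq_bigr => b _.
by rewrite ffunE !mulrDl.
Qed.

Lemma bilinDr (A B C : finType) (op : A -> B -> {ffun C -> k}) :
  forall x y y', bilin op x (y + y') = bilin op x y + bilin op x y'.
Proof.
move=> x y y'; apply/ffunP=> c; rewrite !ffunE -big_split /=.
apply: eq_bigr => a _; rewrite -big_split /=; apply: eq_bigr => b _.
by rewrite ffunE mulrDr mulrDl.
Qed.

Lemma sum_deltal (C : finType) (c : C) (F : C -> k) :
  \sum_d delta k c d * F d = F c.
Proof.
rewrite (bigD1 c) //= big1 ?addr0; first by rewrite ffunE eqxx mul1r.
by move=> d /negPf nd; rewrite ffunE nd mul0r.
Qed.

Lemma bilin_deltal (A B C : finType) (op : A -> B -> {ffun C -> k}) a y c :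
  bilin op (delta k a) y c = \sum_b y b * op a b c.
Proof.
rewrite ffunE; under eq_bigr => a' _.
  under eq_bigr => b _ do rewrite -mulrA.
  rewrite -mulr_sumr; over.
exact: sum_deltal.
Qed.

Lemma bilin_deltar (A B C : finType) (op : A -> B -> {ffun C -> k}) x b c :
  bilin op x (delta k b) c = \sum_a x a * op a b c.
Proof.
rewrite ffunE; apply: eq_bigr => a _.
under eq_bigr => b' _ do rewrite [x a * _]mulrC -mulrA.
exact: sum_deltal.
Qed.

Lemma bilin_delta (A B C : finType) (op : A -> B -> {ffun C -> k}) a b :
  bilin op (delta k a) (delta k b) = op a b.
Proof. by apply/ffunP=> c; rewrite bilin_deltal sum_deltal. Qed.

Lemma bilinA (A B C U V D : finType)
    (op1 : A -> B -> {ffun U -> k}) (op1' : U -> C -> {ffun D -> k})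
    (op2 : B -> C -> {ffun V -> k}) (op2' : A -> V -> {ffun D -> k}) :
  (forall a b c, bilin op1' (op1 a b) (delta k c) =
                 bilin op2' (delta k a) (op2 b c)) ->
  forall x y z, bilin op1' (bilin op1 x y) z = bilin op2' x (bilin op2 y z).
Proof.
move=> H x y z; apply/ffunP=> d; rewrite !ffunE.
transitivity (\sum_a \sum_b \sum_c
                x a * y b * z c * \sum_u op1 a b u * op1' u c d).
  rewrite exchange_big /=.
  under eq_bigr => c _.
    under eq_bigr => u _.
      rewrite ffunE -mulrA mulr_suml.
      under eq_bigr => a _ do rewrite mulr_suml.
      over.
    rewrite exchange_big /=.
    under eq_bigr => a _ do rewrite exchange_big /=.
    over.
  rewrite exchange_big /=; apply: eq_bigr => a _.
  rewrite exchange_big /=; apply: eq_bigr => b _.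
  apply: eq_bigr => c _; rewrite mulr_sumr; apply: eq_bigr => u _.
  by rewrite !mulrA; congr (_ * _); rewrite -!mulrA [op1 _ _ _ * _]mulrC.
transitivity (\sum_a \sum_b \sum_c
                x a * y b * z c * \sum_v op2 b c v * op2' a v d).
  apply: eq_bigr => a _; apply: eq_bigr => b _; apply: eq_bigr => c _.
  by congr (_ * _); have /ffunP/(_ d) := H a b c; rewrite bilin_deltar bilin_deltal.
apply: eq_bigr => a _; symmetry.
under eq_bigr => v _.
  rewrite ffunE mulr_sumr mulr_suml.
  under eq_bigr => b _ do rewrite mulr_sumr mulr_suml.
  over.
rewrite exchange_big /=; apply: eq_bigr => b _.
rewrite exchange_big /=; apply: eq_bigr => c _.
by rewrite mulr_sumr; apply: eq_bigr => v _; rewrite !mulrA.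
Qed.

End Bilinear.

Definition monoid_alg (k : comPzRingType) (B : finType) (e : B)
  (op : Monoid.law e) : Type := {ffun B -> k}.

Section MonoidAlgebra.
Variables (k : comPzRingType) (B : finType) (e : B) (op : Monoid.law e).
Local Notation monoid_alg := (monoid_alg k op).

HB.instance Definition _ := GRing.Zmodule.on monoid_alg.

Definition monoid_alg_mul : monoid_alg -> monoid_alg -> monoid_alg :=
  bilin (fun a b => delta k (op a b)).

Lemma monoid_alg_mulA : associative monoid_alg_mul.
Proof.
move=> x y z; symmetry; apply: bilinA => a b c.
by rewrite !bilin_delta Monoid.mulmA.
Qed.

Lemma monoid_alg_mul1 : left_id (delta k e) monoid_alg_mul.
Proof.
move=> x; apply/ffunP=> c; rewrite bilin_deltal -[RHS](sum_deltal c).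
by apply: eq_bigr => b _; rewrite Monoid.mul1m !ffunE mulrC eq_sym.
Qed.

Lemma monoid_alg_1mul : right_id (delta k e) monoid_alg_mul.
Proof.
move=> x; apply/ffunP=> c; rewrite bilin_deltar -[RHS](sum_deltal c).
by apply: eq_bigr => b _; rewrite Monoid.mulm1 !ffunE mulrC eq_sym.
Qed.

HB.instance Definition _ := GRing.Zmodule_isPzRing.Build monoid_alg
  monoid_alg_mulA monoid_alg_mul1 monoid_alg_1mul
  (bilinDl (fun a b => delta k (op a b)))
  (bilinDr (fun a b => delta k (op a b))).

End MonoidAlgebra.

Notation corr Y X := {set Y * X}.

Definition corr_comp (Z Y X : finType) (S : corr Z Y) (Q : corr Y X) :
    corr Z X :=
  [set zx | [exists y, ((zx.1, y) \in S) && ((y, zx.2) \in Q)]].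

Definition corr_diag (E : finType) : corr E E := [set p | p.1 == p.2].

Definition corr_perm (E : finType) (a : {perm E}) : corr E E :=
  [set (a e, e) | e : E].

Lemma in_corr_comp (Z Y X : finType) (S : corr Z Y) (Q : corr Y X) z x :
  reflect (exists2 y, (z, y) \in S & (y, x) \in Q)
          ((z, x) \in corr_comp S Q).
Proof.
rewrite inE; apply: (iffP existsP) => -[y].
  by case/andP; exists y.
by move=> *; exists y; apply/andP.
Qed.

Lemma corr_compA (W Z Y X : finType) (P : corr W Z) (S : corr Z Y)
    (Q : corr Y X) :
  corr_comp P (corr_comp S Q) = corr_comp (corr_comp P S) Q.
Proof.
apply/setP=> -[w x]; apply/in_corr_comp/in_corr_comp.
  by case=> z wz /in_corr_comp[y zy yx]; exists y => //; apply/in_corr_comp; exists z.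
by case=> y /in_corr_comp[z wz zy] yx; exists z => //; apply/in_corr_comp; exists y.
Qed.

Lemma corr_comp1 (Y X : finType) (Q : corr Y X) :
  corr_comp (corr_diag Y) Q = Q.
Proof.
apply/setP=> -[y x]; apply/in_corr_comp/idP => [[y']|yx].
  by rewrite inE /= => /eqP ->.
by exists y => //; rewrite inE /=.
Qed.

Lemma corr_1comp (Y X : finType) (Q : corr Y X) :
  corr_comp Q (corr_diag X) = Q.
Proof.
apply/setP=> -[y x]; apply/in_corr_comp/idP => [[x']|yx].
  by rewrite inE /= => yx /eqP <-.
by exists x => //; rewrite inE /=.
Qed.

HB.instance Definition _ (E : finType) :=
  Monoid.isLaw.Build (corr E E) (corr_diag E) (@corr_comp E E E)
    (@corr_compA E E E E) (@corr_comp1 E E) (@corr_1comp E E).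

Section CorrespondenceModules.
Variable k : comPzRingType.

Definition kcorr (Y X : finType) : Type := {ffun corr Y X -> k}.
HB.instance Definition _ Y X := GRing.Zmodule.on (kcorr Y X).

Definition kcomp (Z Y X : finType) :
    kcorr Z Y -> kcorr Y X -> kcorr Z X :=
  bilin (fun S Q => delta k (corr_comp S Q)).

Lemma kcompA (W Z Y X : finType) (a : kcorr W Z) (b : kcorr Z Y)
    (c : kcorr Y X) : kcomp a (kcomp b c) = kcomp (kcomp a b) c.
Proof. by symmetry; apply: bilinA => S Q P; rewrite !bilin_delta corr_compA. Qed.

Definition kcorr_alg (E : finType) : pzRingType :=
  monoid_alg k (@corr_comp E E E).

Variables X E : finType.

(* kC(X, E) as a right kC(E, E)-module.                                       *)
Definition kcorr_rmod : Type := kcorr X E.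
HB.instance Definition _ := GRing.Zmodule.on kcorr_rmod.

Definition kcorr_rscale (a : (kcorr_alg E)^c) (phi : kcorr_rmod) :
  kcorr_rmod := kcomp phi a.

Lemma kcorr_rscaleA (a b : (kcorr_alg E)^c) (phi : kcorr_rmod) :
  kcorr_rscale a (kcorr_rscale b phi) = kcorr_rscale (a * b) phi.
Proof. by symmetry; apply: kcompA. Qed.

Lemma kcorr_rscale1 : left_id 1 kcorr_rscale.
Proof.
move=> phi; apply/ffunP=> S; rewrite [LHS]bilin_deltar -[RHS](sum_deltal S).
by apply: eq_bigr => b _; rewrite corr_1comp !ffunE mulrC eq_sym.
Qed.

Lemma kcorr_rscaleDr : right_distributive kcorr_rscale +%R.
Proof. by move=> a x y; apply: bilinDl. Qed.

Lemma kcorr_rscaleDl (phi : kcorr_rmod) :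
  {morph kcorr_rscale^~ phi : a b / a + b}.
Proof. by move=> a b; apply: bilinDr. Qed.

HB.instance Definition _ := GRing.Zmodule_isLmodule.Build (kcorr_alg E)^c
  kcorr_rmod kcorr_rscaleA kcorr_rscale1 kcorr_rscaleDr kcorr_rscaleDl.

End CorrespondenceModules.

(* M (x)_A N for a right A-module M and a left A-module N: the free abelian   *)
(* group on M * N modulo the subgroup generated by the biadditivity and       *)
(* A-balancedness relations.                                                  *)

Section Tensor.
Variables (A : pzRingType) (M : lmodType A^c) (N : lmodType A).

Definition fpair (m : M) (n : N) : {freeg (M * N)%type / int} :=
  [freeg [:: (1, (m, n))]].

Inductive tensor_rel : {freeg (M * N)%type / int} -> Prop :=
| TensorRel0 : tensor_rel 0
| TensorRelB u v : tensor_rel u -> tensor_rel v -> tensor_rel (u - v)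
| TensorRelDl m m' n :
    tensor_rel (fpair (m + m') n - fpair m n - fpair m' n)
| TensorRelDr m n n' :
    tensor_rel (fpair m (n + n') - fpair m n - fpair m n')
| TensorRelZ (a : A) m n :
    tensor_rel (fpair ((a : A^c) *: m) n - fpair m (a *: n)).

Definition tensor_pred : {pred {freeg (M * N)%type / int}} :=
  fun u => `[< tensor_rel u >].

Lemma tensor_pred_zmod : zmod_closed tensor_pred.
Proof.
split; first by apply/asboolP; exact: TensorRel0.
by move=> u v /asboolP hu /asboolP hv; apply/asboolP; exact: TensorRelB.
Qed.

HB.instance Definition _ :=
  GRing.isZmodClosed.Build _ tensor_pred tensor_pred_zmod.

Definition tensor : Type := Quotient.quot tensor_pred.
HB.instance Definition _ := GRing.Zmodule.on tensor.
HB.instance Definition _ :=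
  ZmodQuotient.on tensor.

Definition tens (m : M) (n : N) : tensor := \pi_tensor (fpair m n).

Lemma tensor_eq0 u : tensor_rel u -> \pi_tensor u = 0.
Proof.
move=> hu; rewrite -[RHS](raddf0 (\pi_tensor)); apply/eqP.
by rewrite -Quotient.idealrBE subr0; apply/asboolP.
Qed.

Lemma tensDl m m' n : tens (m + m') n = tens m n + tens m' n.
Proof.
apply/eqP; rewrite -subr_eq0 opprD addrA -!raddfB.
by apply/eqP/tensor_eq0/TensorRelDl.
Qed.

Lemma tensDr m n n' : tens m (n + n') = tens m n + tens m n'.
Proof.
apply/eqP; rewrite -subr_eq0 opprD addrA -!raddfB.
by apply/eqP/tensor_eq0/TensorRelDr.
Qed.

Lemma tensZ (a : A) m n : tens ((a : A^c) *: m) n = tens m (a *: n).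
Proof.
by apply/eqP; rewrite -subr_eq0 -raddfB; apply/eqP/tensor_eq0/TensorRelZ.
Qed.

Lemma tensNl m n : tens (- m) n = - tens m n.
Proof.
have h0 : tens 0 n = 0 by apply: (addrI (tens 0 n)); rewrite -tensDl !addr0.
by apply/eqP; rewrite -addr_eq0 -tensDl addNr h0.
Qed.

Lemma tensor_sum (x : tensor) :
  exists s : seq (M * N), x = \sum_(p <- s) tens p.1 p.2.
Proof.
elim/quotW: x => u; rewrite -[u]freeg_sumE raddf_sum /=.
elim: (dom u) => [|p r [s IH]]; first by exists [::]; rewrite !big_nil.
suff [t ht] : exists t : seq (M * N),
    \pi_tensor << coeff p u *g p >> = \sum_(q <- t) tens q.1 q.2.
  by exists (t ++ s); rewrite big_cons big_cat /= ht IH.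
have E z : \pi_tensor << z *g p >> = tens p.1 p.2 *~ z.
  rewrite -raddfMz /fpair -surjective_pairing.
  by congr (\pi _); rewrite freegU_mulz intz.
rewrite E; case: (coeff p u) => n.
  exists (nseq n p); elim: n => [|n IHn] /=; first by rewrite big_nil.
  by rewrite big_cons -IHn -!pmulrn mulrS.
exists (nseq n.+1 (- p.1, p.2)); rewrite NegzE mulrNz -mulNrz -tensNl.
elim: n => [|n IHn]; first by rewrite big_seq1.
by rewrite big_cons -IHn -!pmulrn mulrS.
Qed.

Section Lift.
Variables (Z : zmodType) (f : M -> N -> Z).
Hypothesis fDl : forall m m' n, f (m + m') n = f m n + f m' n.
Hypothesis fDr : forall m n n', f m (n + n') = f m n + f m n'.
Hypothesis fZ : forall (a : A) m n, f ((a : A^c) *: m) n = f m (a *: n).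

Let flift (u : {freeg (M * N)%type / int}) : Z :=
  fglift (fun p : M * N => f p.1 p.2 : zmodule Z) u.

Let fliftB u v : flift (u - v) = flift u - flift v.
Proof. exact: (lift_is_additive (M := zmodule Z)). Qed.

Let flift_pair m n : flift (fpair m n) = f m n.
Proof. exact: (liftU (M := zmodule Z)). Qed.

Let flift_rel u : tensor_rel u -> flift u = 0.
Proof.
elim=> {u} [|u v _ hu _ hv|m m' n|m n n'|a m n].
- by rewrite -[X in flift X](subrr 0) fliftB subrr.
- by rewrite fliftB hu hv subrr.
- by rewrite !fliftB !flift_pair fDl addrAC addrK subrr.
- by rewrite !fliftB !flift_pair fDr addrAC addrK subrr.
- by rewrite !fliftB !flift_pair fZ subrr.
Qed.

Definition tensor_lift (x : tensor) : Z := flift (generic_quotient.repr x).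

Let tensor_lift_pi u : tensor_lift (\pi_tensor u) = flift u.
Proof.
apply/eqP; rewrite -subr_eq0 -fliftB; apply/eqP/flift_rel/asboolP.
have := Quotient.idealrBE tensor_pred (generic_quotient.repr (\pi_tensor u)) u.
by rewrite reprK eqxx.
Qed.

Lemma tensor_liftB : zmod_morphism tensor_lift.
Proof.
elim/quotW=> u; elim/quotW=> v.
by rewrite -raddfB !tensor_lift_pi fliftB.
Qed.

Lemma tensor_lift_tens m n : tensor_lift (tens m n) = f m n.
Proof. by rewrite tensor_lift_pi flift_pair. Qed.

End Lift.

End Tensor.

(* [LJ_eval W X] is L_{E,W}(X) / J_{E,W}(X).                                  *)

Section Functors.
Variables (k : comPzRingType) (E : finType).

Definition L_eval (W : lmodType (kcorr_alg k E)) (X : finType) : zmodType :=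
  tensor (kcorr_rmod k X E) W.

Section J.
Variables (W : lmodType (kcorr_alg k E)) (X : finType).

Definition J_mem (x : L_eval W X) : Prop :=
  exists s : seq (kcorr_rmod k X E * W),
    x = \sum_(p <- s) tens p.1 p.2 /\
    forall rho : kcorr k E X,
      \sum_(p <- s) (kcomp rho p.1 : kcorr_alg k E) *: p.2 = 0.

Definition J_pred : {pred L_eval W X} := fun x => `[< J_mem x >].

Lemma J_pred_zmod : zmod_closed J_pred.
Proof.
split; first by apply/asboolP; exists [::]; split=> [|rho]; rewrite big_nil.
move=> x y /asboolP[s [-> hs]] /asboolP[t [-> ht]]; apply/asboolP.
exists (s ++ [seq (p.1, - p.2) | p <- t]); split=> [|rho].
  rewrite big_cat big_map -sumrN /=; congr (_ + _); apply: eq_bigr => p _.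
  by apply/eqP; rewrite eq_sym -addr_eq0 -tensDr addNr; apply/eqP; apply: (addrI (tens p.1 0)); rewrite -tensDr !addr0.
rewrite big_cat big_map /= hs add0r.
transitivity (- \sum_(p <- t) (kcomp rho p.1 : kcorr_alg k E) *: p.2).
  by rewrite -sumrN; apply: eq_bigr => p _; rewrite scalerN.
by rewrite ht oppr0.
Qed.

HB.instance Definition _ := GRing.isZmodClosed.Build _ J_pred J_pred_zmod.

Definition LJ_eval : Type := Quotient.quot J_pred.
HB.instance Definition _ := GRing.Zmodule.on LJ_eval.
HB.instance Definition _ := ZmodQuotient.on LJ_eval.

Definition LJ_class (x : L_eval W X) : LJ_eval := \pi_LJ_eval x.

Lemma LJ_classP x y : reflect (LJ_class x = LJ_class y) (x - y \in J_pred).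
Proof. by rewrite Quotient.idealrBE; apply: eqP. Qed.

Lemma LJ_classB : zmod_morphism LJ_class.
Proof. by move=> x y; rewrite /LJ_class raddfB. Qed.

HB.instance Definition _ :=
  GRing.isZmodMorphism.Build (L_eval W X) LJ_eval LJ_class LJ_classB.

Definition LJ_tens (phi : kcorr_rmod k X E) (w : W) : LJ_eval :=
  LJ_class (tens phi w).

Lemma LJ_sum (x : LJ_eval) :
  exists s : seq (kcorr_rmod k X E * W), x = \sum_(p <- s) LJ_tens p.1 p.2.
Proof.
elim/quotW: x => y; have [s ->] := tensor_sum y; exists s.
exact: (raddf_sum LJ_class).
Qed.

End J.

(* A kC(E, E)-linear map W -> W' induces maps L_{E,W}(X) -> L_{E,W'}(X) and   *)
(* L_{E,W}(X) / J_{E,W}(X) -> L_{E,W'}(X) / J_{E,W'}(X).                      *)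

Section Map.
Variables (W W' : lmodType (kcorr_alg k E)) (f : {linear W -> W'}).
Variable X : finType.

Definition L_map : L_eval W X -> L_eval W' X :=
  tensor_lift (fun (phi : kcorr_rmod k X E) w => tens phi (f w)).

Let tfDl (m m' : kcorr_rmod k X E) n :
  tens (m + m') (f n) = tens m (f n) + tens m' (f n).
Proof. exact: tensDl. Qed.

Let tfDr (m : kcorr_rmod k X E) n n' :
  tens m (f (n + n')) = tens m (f n) + tens m (f n').
Proof. by rewrite raddfD tensDr. Qed.

Let tfZ (a : kcorr_alg k E) (m : kcorr_rmod k X E) n :
  tens ((a : (kcorr_alg k E)^c) *: m) (f n) = tens m (f (a *: n)).
Proof. by rewrite linearZ /= tensZ. Qed.

Lemma L_map_tens phi w : L_map (tens phi w) = tens phi (f w).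
Proof. exact: (tensor_lift_tens tfDl tfDr tfZ). Qed.

Lemma L_mapB : zmod_morphism L_map.
Proof. exact: (tensor_liftB tfDl tfDr tfZ). Qed.

HB.instance Definition _ :=
  GRing.isZmodMorphism.Build (L_eval W X) (L_eval W' X) L_map L_mapB.

Lemma L_map_J x : x \in @J_pred W X -> L_map x \in @J_pred W' X.
Proof.
move=> /asboolP[s [-> hs]]; apply/asboolP.
exists [seq (p.1, f p.2) | p <- s]; split=> [|rho].
  by rewrite big_map raddf_sum; apply: eq_bigr => p _; exact: L_map_tens.
rewrite big_map /= -[RHS](raddf0 f) -(hs rho) raddf_sum.
by apply: eq_bigr => p _ /=; rewrite linearZ.
Qed.

Definition LJ_map (x : LJ_eval W X) : LJ_eval W' X :=
  LJ_class (L_map (generic_quotient.repr x)).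

Lemma LJ_map_class x : LJ_map (LJ_class x) = LJ_class (L_map x).
Proof.
apply/LJ_classP; rewrite -raddfB; apply/L_map_J/LJ_classP.
exact: generic_quotient.reprK.
Qed.

Lemma LJ_map_tens phi w : LJ_map (LJ_tens phi w) = LJ_tens phi (f w).
Proof. by rewrite LJ_map_class L_map_tens. Qed.

Lemma LJ_mapB : zmod_morphism LJ_map.
Proof.
elim/quotW=> x; elim/quotW=> y.
by rewrite -!/(LJ_class _) -raddfB !LJ_map_class !raddfB.
Qed.

HB.instance Definition _ :=
  GRing.isZmodMorphism.Build (LJ_eval W X) (LJ_eval W' X) LJ_map LJ_mapB.

End Map.

End Functors.

(* An order is needed here as an element R of C(E, E), together with the      *)
(* opposite order on the same set E; hence this record rather than an         *)
(* instance of finPOrderType.                                                 *)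

Record order_on (E : finType) := OrderOn {
  order_corr :> corr E E;
  order_refl : forall e, (e, e) \in order_corr;
  order_anti : forall e f,
    (e, f) \in order_corr -> (f, e) \in order_corr -> e = f;
  order_trans : forall e f g,
    (e, f) \in order_corr -> (f, g) \in order_corr -> (e, g) \in order_corr
}.

Section OppositeOrder.
Variables (E : finType) (R : order_on E).

Definition opp_corr : corr E E := [set p | (p.2, p.1) \in (R : corr E E)].

Lemma opp_corr_refl e : (e, e) \in opp_corr.
Proof. by rewrite inE order_refl. Qed.

Lemma opp_corr_anti e f :
  (e, f) \in opp_corr -> (f, e) \in opp_corr -> e = f.
Proof. by rewrite !inE => ef fe; apply: order_anti fe ef. Qed.

Lemma opp_corr_trans e f g :
  (e, f) \in opp_corr -> (f, g) \in opp_corr -> (e, g) \in opp_corr.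
Proof. by rewrite !inE => ef fg; apply: order_trans fg ef. Qed.

Definition opp_order : order_on E :=
  OrderOn opp_corr_refl opp_corr_anti opp_corr_trans.

Definition Aut_order : {set {perm E}} :=
  [set a : {perm E} | [forall e, forall f,
     ((a e, a f) \in (R : corr E E)) == ((e, f) \in (R : corr E E))]].

Lemma Aut_orderP (a : {perm E}) :
  reflect (forall e f,
            ((a e, a f) \in (R : corr E E)) = ((e, f) \in (R : corr E E)))
          (a \in Aut_order).
Proof.
rewrite inE; apply: (iffP forallP) => H e; last by apply/forallP=> f; apply/eqP.
by move=> f; apply/eqP; move/forallP: (H e); apply.
Qed.

Lemma Aut_order_group_set : group_set Aut_order.
Proof.
apply/group_setP; split; first by apply/Aut_orderP=> e f; rewrite !perm1.
move=> a b /Aut_orderP ha /Aut_orderP hb; apply/Aut_orderP=> e f.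
by rewrite !permM hb ha.
Qed.

Canonical Aut_order_group := Group Aut_order_group_set.

End OppositeOrder.

Lemma Aut_opp_order (E : finType) (R : order_on E) :
  Aut_order (opp_order R) = Aut_order R.
Proof.
by apply/setP=> a; apply/Aut_orderP/Aut_orderP=> H e f; have := H f e; rewrite !inE.
Qed.

(* Composition of permutations: [pcomp a b] is a after b, whereas the product *)
(* a * b of {perm E} is b after a.  The group algebra below is taken with     *)
(* respect to composition.                                                    *)

Section Composition.
Variable gT : finGroupType.

Definition pcomp (a b : gT) : gT := (b * a)%g.

Lemma pcompA : associative pcomp.
Proof. by move=> a b c; rewrite /pcomp mulgA. Qed.

Lemma pcomp1 : left_id 1%g pcomp.
Proof. by move=> a; rewrite /pcomp mulg1. Qed.

Lemma p1comp : right_id 1%g pcomp.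
Proof. by move=> a; rewrite /pcomp mul1g. Qed.

HB.instance Definition _ :=
  Monoid.isLaw.Build gT 1%g pcomp pcompA pcomp1 p1comp.

End Composition.

Definition kgroup_alg (k : comPzRingType) (E : finType)
  (G : {group {perm E}}) : pzRingType := monoid_alg k (@pcomp (subg_of G)).

(* The fundamental module P_E f_R: [delta k a] stands for the basis element   *)
(* Delta_a f_R.                                                               *)

Definition fund_mod (k : comPzRingType) (E : finType) (R : order_on E) : Type :=
  {ffun {perm E} -> k}.

Section FundamentalModule.
Variables (k : comPzRingType) (E : finType) (R : order_on E).
Implicit Types (a b c : {perm E}) (Q : corr E E).

(* ^aR *)
Definition conj_corr a : corr E E := [set (a p.1, a p.2) | p in (R : corr E E)].

Definition fund_cond Q a b : bool :=
  (corr_diag E \subset corr_comp (corr_perm b^-1) Q) &&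
  (corr_comp (corr_perm b^-1) Q \subset conj_corr a).

Definition fund_act Q a : {ffun {perm E} -> k} :=
  if [pick b | fund_cond Q a b] is Some b then delta k (pcomp b a) else 0.

Lemma in_conj_corr a e f :
  ((e, f) \in conj_corr a) = ((a^-1 e, a^-1 f)%g \in (R : corr E E)).
Proof.
apply/imsetP/idP => [[[x y] xy /= [-> ->]]|ef]; first by rewrite !permK.
by exists (a^-1 e, a^-1 f)%g => //=; rewrite !permKV.
Qed.

Lemma in_corr_perm_comp b Q e f :
  ((e, f) \in corr_comp (corr_perm b^-1) Q) = ((b e, f) \in Q).
Proof.
apply/in_corr_comp/idP => [[y /imsetP[x _ [-> ->]]]|bf]; first by rewrite permKV.
exists (b e) => //; apply/imsetP; exists (b e) => //; by rewrite permK.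
Qed.

Lemma fund_condP Q a b :
  reflect ((forall e, (b e, e) \in Q) /\
           (forall e f, (b e, f) \in Q -> (a^-1 e, a^-1 f)%g \in (R : corr E E)))
          (fund_cond Q a b).
Proof.
apply: (iffP andP) => [] [H1 H2]; split.
- by move=> e; rewrite -in_corr_perm_comp; apply: (subsetP H1); rewrite inE.
- move=> e f; rewrite -in_corr_perm_comp => /(subsetP H2).
  by rewrite in_conj_corr.
- apply/subsetP=> -[e f]; rewrite inE /= => /eqP <-.
  by rewrite in_corr_perm_comp.
- apply/subsetP=> -[e f]; rewrite in_corr_perm_comp in_conj_corr; exact: H2.
Qed.

Lemma perm_below_id b : (forall e, (b e, e) \in (R : corr E E)) -> b = 1%g.
Proof.
move=> H; apply/permP=> e; rewrite perm1.
have Hn n x : ((b ^+ n)%g x, x) \in (R : corr E E).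
  elim: n x => [|n IHn] x; first by rewrite expg0 perm1 order_refl.
  by rewrite expgSr permM; apply: order_trans (H _) (IHn x).
apply: order_anti (H e) _; have := Hn #[b]%g.-1 (b e).
by rewrite -permM -expgS prednK ?order_gt0 // expg_order perm1.
Qed.

Lemma fund_cond_uniq Q a b b' : fund_cond Q a b -> fund_cond Q a b' -> b = b'.
Proof.
move=> /fund_condP[_ H2] /fund_condP[H1 _].
have H y : ((a * b' * b^-1 * a^-1)%g y, y) \in (R : corr E E).
  rewrite !permM -[X in (_, X)](permK a); apply: H2.
  by rewrite permKV; exact: H1.
move/perm_below_id: H => /(canRL (mulgK _)); rewrite mul1g invgK => /eqP.
rewrite -mulgA -{2}[a]mulg1 => /eqP/mulgI/(canRL (mulgK _)).
by rewrite mul1g invgK => ->.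
Qed.

Lemma fund_actE Q a b :
  fund_cond Q a b -> fund_act Q a = delta k (pcomp b a).
Proof.
rewrite /fund_act => H; case: pickP => [c Hc|/(_ b)]; last by rewrite H.
by rewrite (fund_cond_uniq Hc H).
Qed.

Lemma fund_act0 Q a : (forall b, ~~ fund_cond Q a b) -> fund_act Q a = 0.
Proof. by rewrite /fund_act => H; case: pickP => // b; rewrite (negPf (H b)). Qed.

Variant fund_act_spec Q a : {ffun {perm E} -> k} -> Prop :=
| FundAct b of fund_cond Q a b : fund_act_spec Q a (delta k (pcomp b a))
| FundAct0 of (forall b, ~~ fund_cond Q a b) : fund_act_spec Q a 0.

Lemma fund_actP Q a : fund_act_spec Q a (fund_act Q a).
Proof.
rewrite /fund_act; case: pickP => [b|] H; constructor=> // b.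
by rewrite H.
Qed.

Lemma fund_cond_comp Q Q' a b c :
  fund_cond Q' a b -> fund_cond Q (pcomp b a) c ->
  fund_cond (corr_comp Q Q') a (pcomp c b).
Proof.
move=> /fund_condP[H1 H2] /fund_condP[K1 K2]; apply/fund_condP; split=> [e|e f].
  by rewrite permM; apply/in_corr_comp; exists (b e).
rewrite permM => /in_corr_comp[y cy yf].
move: (K2 _ _ cy); rewrite invMg !permM permK => /order_trans; apply.
by apply: H2; rewrite permKV.
Qed.

Lemma fund_cond_split Q Q' a d :
  fund_cond (corr_comp Q Q') a d ->
  exists b c, fund_cond Q' a b /\ fund_cond Q (pcomp b a) c.
Proof.
move=> /fund_condP[H1 H2].
have /fin_all_exists2[h hQ hQ'] e :
    exists2 y, (d e, y) \in Q & (y, e) \in Q'.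
  exact/in_corr_comp.
have h_inj : injective h.
  move=> e e' ee'; apply: (@perm_inj _ a^-1%g); apply: order_anti.
    by apply: H2; apply/in_corr_comp; exists (h e) => //; rewrite ee'.
  by apply: H2; apply/in_corr_comp; exists (h e') => //; rewrite -ee'.
have hK e : h ((perm h_inj)^-1%g e) = e by rewrite -[RHS](permKV (perm h_inj)) permE.
exists (perm h_inj), (pcomp d (perm h_inj)^-1%g); split; apply/fund_condP; split.
- by move=> e; rewrite permE.
- by move=> e f; rewrite permE => ef; apply: H2; apply/in_corr_comp; exists (h e).
- by move=> e; rewrite permM -{2}[e]hK; exact: hQ.
- move=> e f; rewrite permM invMg !permM => ef; apply: H2; apply/in_corr_comp.
  by exists f => //; rewrite -{1}[f]hK.
Qed.

Lemma fund_cond1 a : fund_cond (corr_diag E) a 1%g.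
Proof.
apply/fund_condP; split=> [e|e f]; rewrite inE perm1 //= => /eqP <-.
exact: order_refl.
Qed.

Lemma fund_cond_Aut Q a b (t : {perm E}) :
  t \in Aut_order R -> fund_cond Q (pcomp a t) b = fund_cond Q a b.
Proof.
move=> /Aut_orderP Ht; rewrite /fund_cond; congr (_ && _).
suff -> : conj_corr (pcomp a t) = conj_corr a by [].
apply/setP=> -[e f].
by rewrite !in_conj_corr invMg !permM -[LHS]Ht !permKV.
Qed.

Local Notation fund_mod := (fund_mod k R).

HB.instance Definition _ := GRing.Zmodule.on fund_mod.

Definition fund_scale : kcorr_alg k E -> fund_mod -> fund_mod := bilin fund_act.

Lemma fund_scaleA (x y : kcorr_alg k E) (w : fund_mod) :
  fund_scale x (fund_scale y w) = fund_scale (x * y) w.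
Proof.
symmetry; apply: bilinA => Q Q' a; rewrite bilin_delta.
case: (fund_actP Q' a) => [b Hb|H0].
  rewrite bilin_delta; case: (fund_actP Q (pcomp b a)) => [c Hc|H0].
    by rewrite (fund_actE (fund_cond_comp Hb Hc)) pcompA.
  apply: fund_act0 => d; apply/negP=> /fund_cond_split[b' [c [Hb' Hc]]].
  by rewrite (fund_cond_uniq Hb' Hb) in Hc; move: (H0 c); rewrite Hc.
have -> : bilin fund_act (delta k Q) 0 = 0.
  by apply: (addrI (bilin fund_act (delta k Q) 0)); rewrite -bilinDr !addr0.
apply: fund_act0 => d; apply/negP=> /fund_cond_split[b' [c [Hb' Hc]]].
by move: (H0 b'); rewrite Hb'.
Qed.

Lemma fund_scale1 : left_id 1 fund_scale.
Proof.
move=> w; apply/ffunP=> c; rewrite [LHS]bilin_deltal -[RHS](sum_deltal c).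
apply: eq_bigr => b _; rewrite (fund_actE (fund_cond1 b)) pcomp1.
by rewrite !ffunE mulrC eq_sym.
Qed.

Lemma fund_scaleDr : right_distributive fund_scale +%R.
Proof. by move=> x y y'; apply: bilinDr. Qed.

Lemma fund_scaleDl (w : fund_mod) :
  {morph fund_scale^~ w : x y / x + y}.
Proof. by move=> x y; apply: bilinDl. Qed.

HB.instance Definition _ := GRing.Zmodule_isLmodule.Build (kcorr_alg k E)
  fund_mod fund_scaleA fund_scale1 fund_scaleDr fund_scaleDl.

End FundamentalModule.

(* The right action of kG, for a group G of automorphisms of (E, R), which    *)
(* makes it commute with the action of kC(E, E).                              *)

Definition fund_ract (k : comPzRingType) (E : finType) (R : order_on E)
    (G : {group {perm E}}) (sGR : G \subset Aut_order R)
    (t : kgroup_alg k G) (w : fund_mod k R) : fund_mod k R :=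
  bilin (fun a (u : subg_of G) => delta k (pcomp a (sgval u))) w t.

Section FundamentalBimodule.
Variables (k : comPzRingType) (E : finType) (R : order_on E).
Variables (G : {group {perm E}}) (sGR : G \subset Aut_order R).
Local Notation fund_mod := (fund_mod k R).
Local Notation fund_ract := (@fund_ract k E R G sGR).

Lemma fund_ractB t : zmod_morphism (fund_ract t).
Proof.
move=> w w'; apply: (addIr (fund_ract t w')).
by rewrite -[LHS]bilinDl !subrK.
Qed.

Lemma fund_ractZ t : scalable (fund_ract t).
Proof.
move=> x w; apply: bilinA => Q a u /=; rewrite bilin_delta.
have Hu : sgval u \in Aut_order R := subsetP sGR _ (subgP u).
case: (fund_actP k R Q a) => [b Hb|H0].
  by rewrite !bilin_delta (@fund_actE k E R _ _ b) ?fund_cond_Aut // pcompA.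
rewrite fund_act0 => [|b]; last by rewrite fund_cond_Aut.
by apply/ffunP=> c; rewrite bilin_deltar big1 ?ffunE // => d; rewrite ffunE mul0r.
Qed.

Section RightAction.
Variable t : kgroup_alg k G.

HB.instance Definition _ := GRing.isZmodMorphism.Build fund_mod fund_mod
  (fund_ract t) (fund_ractB t).
HB.instance Definition _ := GRing.isScalable.Build (kcorr_alg k E)
  fund_mod fund_mod *:%R (fund_ract t) (fund_ractZ t).

End RightAction.

Lemma fund_ractA (t u : kgroup_alg k G) w :
  fund_ract u (fund_ract t w) = fund_ract (t * u) w.
Proof. by apply: bilinA => a b c; rewrite !bilin_delta pcompA. Qed.

Lemma fund_ract1 w : fund_ract 1 w = w.
Proof.
apply/ffunP=> c; rewrite [LHS]bilin_deltar -[RHS](sum_deltal c).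
by apply: eq_bigr => b _; rewrite p1comp !ffunE mulrC eq_sym.
Qed.

Lemma fund_ractDl t u w : fund_ract (t + u) w = fund_ract t w + fund_ract u w.
Proof. exact: bilinDr. Qed.

End FundamentalBimodule.

(* [fund_eval k R X] is S_{E,R}(X), and [fund_rmod k R sGR X] is the same     *)
(* group as a right kG-module; G is a parameter because Aut(E, R) also acts   *)
(* on S_{E,R^op}(X), Aut(E, R) and Aut(E, R^op) being only provably equal.    *)

Definition fund_eval (k : comPzRingType) (E : finType) (R : order_on E)
  (X : finType) : zmodType := LJ_eval (fund_mod k R) X.

Definition fund_rmod (k : comPzRingType) (E : finType) (R : order_on E)
  (G : {group {perm E}}) (sGR : G \subset Aut_order R) (X : finType) : Type :=
  fund_eval k R X.
Arguments fund_rmod k {E} R {G} sGR X.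

Section FundamentalFunctor.
Variables (k : comPzRingType) (E : finType) (R : order_on E).
Variables (G : {group {perm E}}) (sGR : G \subset Aut_order R) (X : finType).
Local Notation fund_rmod := (fund_rmod k R sGR X).

HB.instance Definition _ := GRing.Zmodule.on fund_rmod.

Definition fund_rscale (t : (kgroup_alg k G)^c) (x : fund_rmod) : fund_rmod :=
  LJ_map (fund_ract sGR t) x.

Lemma fund_rscale_tens (t : (kgroup_alg k G)^c) phi (w : fund_mod k R) :
  fund_rscale t (LJ_tens phi w) = LJ_tens phi (fund_ract sGR t w).
Proof. exact: LJ_map_tens. Qed.

Lemma fund_rscaleDr : right_distributive fund_rscale +%R.
Proof. by move=> t x y; rewrite /fund_rscale raddfD. Qed.

Lemma fund_rscaleA (t u : (kgroup_alg k G)^c) (x : fund_rmod) :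
  fund_rscale t (fund_rscale u x) = fund_rscale (t * u) x.
Proof.
have [s ->] := LJ_sum x.
rewrite /fund_rscale !raddf_sum; apply: eq_bigr => p _ /=.
by rewrite !LJ_map_tens; congr (LJ_tens _ _); exact: fund_ractA.
Qed.

Lemma fund_rscale1 : left_id 1 fund_rscale.
Proof.
move=> x; have [s ->] := LJ_sum x.
rewrite /fund_rscale raddf_sum; apply: eq_bigr => p _ /=.
by rewrite LJ_map_tens; congr (LJ_tens _ _); exact: fund_ract1.
Qed.

Lemma LJ_tensDr phi (w w' : fund_mod k R) :
  LJ_tens (X := X) phi (w + w') = LJ_tens phi w + LJ_tens phi w'.
Proof. by rewrite /LJ_tens tensDr raddfD. Qed.

Lemma fund_rscaleDl (x : fund_rmod) :
  {morph fund_rscale^~ x : t u / t + u}.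
Proof.
move=> t u; have [s ->] := LJ_sum x.
rewrite /fund_rscale !raddf_sum -big_split; apply: eq_bigr => p _ /=.
by rewrite !LJ_map_tens -LJ_tensDr; congr (LJ_tens _ _); exact: fund_ractDl.
Qed.

HB.instance Definition _ := GRing.Zmodule_isLmodule.Build (kgroup_alg k G)^c
  fund_rmod fund_rscaleA fund_rscale1 fund_rscaleDr fund_rscaleDl.

End FundamentalFunctor.

Lemma Aut_order_sub_opp (E : finType) (R : order_on E) :
  Aut_order R \subset Aut_order (opp_order R).
Proof. by rewrite Aut_opp_order. Qed.

(* finTBLatticeType is the type of nonempty finite lattices, which have a     *)
(* bottom and a top.  The empty join is the bottom.                           *)

Section Lattice.
Variables (d : Order.disp_t) (T : finTBLatticeType d).

Definition irreducible (e : T) : bool :=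
  [forall A : {set T}, (e == \join_(a in A) a)%O ==> (e \in A)].

Definition Aut_lattice : {set {perm T}} :=
  [set phi : {perm T} | [forall x, forall y,
     (phi (x `&` y) == phi x `&` phi y)%O &&
     (phi (x `|` y) == phi x `|` phi y)%O]].

Lemma Aut_latticeP (phi : {perm T}) :
  reflect ({morph phi : x y / (x `&` y)%O} /\ {morph phi : x y / (x `|` y)%O})
          (phi \in Aut_lattice).
Proof.
rewrite inE; apply: (iffP forallP) => [H|[HI HU] x].
  by split=> x y; have /forallP/(_ y)/andP[/eqP ? /eqP ?] := H x.
by apply/forallP=> y; rewrite HI HU !eqxx.
Qed.

Lemma Aut_lattice_group_set : group_set Aut_lattice.
Proof.
apply/group_setP; split; first by apply/Aut_latticeP; split=> x y; rewrite !perm1.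
move=> a b /Aut_latticeP[aI aU] /Aut_latticeP[bI bU].
by apply/Aut_latticeP; split=> x y; rewrite !permM ?aI ?bI ?aU ?bU.
Qed.

Canonical Aut_lattice_group := Group Aut_lattice_group_set.

Lemma Aut_lattice_mono (phi : {perm T}) :
  phi \in Aut_lattice -> {mono phi : x y / (x <= y)%O}.
Proof.
move=> /Aut_latticeP[_ HU] x y.
by rewrite !leEjoin -HU (inj_eq perm_inj).
Qed.

Lemma Aut_lattice_join (phi : {perm T}) (A : {set T}) :
  phi \in Aut_lattice ->
  (phi (\join_(a in A) a) = \join_(a in phi @: A) a)%O.
Proof.
move=> phiA; have [_ HU] := Aut_latticeP _ phiA.
have H0 : phi \bot%O = \bot%O.
  apply/eqP; rewrite -lex0 -{2}[\bot%O](permKV phi).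
  by rewrite (Aut_lattice_mono phiA) le0x.
by rewrite big_imset ?(big_morph phi HU H0) //= => x y _ _; apply: perm_inj.
Qed.

Lemma Aut_lattice_irreducible (phi : {perm T}) e :
  phi \in Aut_lattice -> irreducible (phi e) = irreducible e.
Proof.
have sub (psi : {perm T}) x :
    psi \in Aut_lattice -> irreducible (psi x) -> irreducible x.
  move=> psiA /forallP H; apply/forallP=> A; apply/implyP=> /eqP xE.
  have /implyP := H (psi @: A); rewrite -Aut_lattice_join // -xE eqxx.
  by rewrite mem_imset ?perm_inj //; [apply|apply: perm_inj].
move=> phiA; apply/idP/idP; first exact: sub.
by rewrite -{1}[e](permK phi); apply: sub; rewrite groupV.
Qed.

End Lattice.

(* [is_Irr R iota]: iota identifies the poset (E, R) with the poset Irr(T).   *)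
(* [Aut_restr iota phi] is then the restriction to E of a lattice             *)
(* automorphism phi (see Aut_restrE).                                         *)

Section Irreducibles.
Variables (E : finType) (R : order_on E).
Variables (d : Order.disp_t) (T : finTBLatticeType d) (iota : E -> T).

Definition is_Irr : Prop :=
  (forall e f, ((e, f) \in (R : corr E E)) = (iota e <= iota f)%O) /\
  (forall t, irreducible t <-> exists e, iota e = t).

Definition Aut_restr (phi : {perm T}) : {perm E} :=
  if [pick a : {perm E} | [forall e, iota (a e) == phi (iota e)]] is Some a
  then a else 1%g.

Hypothesis irrE : is_Irr.

Lemma is_Irr_inj : injective iota.
Proof.
by move=> e f ef; apply: (@order_anti _ R); rewrite irrE.1 ef lexx.
Qed.

Lemma Aut_restrE (phi : {perm T}) e :
  phi \in Aut_lattice T -> iota (Aut_restr phi e) = phi (iota e).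
Proof.
move=> phiA; rewrite /Aut_restr; case: pickP => [a /forallP/(_ e)/eqP //|].
have /fin_all_exists[h hE] f : exists g, iota g = phi (iota f).
  by apply/irrE.2; rewrite Aut_lattice_irreducible //; apply/irrE.2; exists f.
have h_inj : injective h.
  by move=> f f' ff'; apply/is_Irr_inj/(@perm_inj _ phi); rewrite -!hE ff'.
move=> /(_ (perm h_inj)) /negP[]; apply/forallP=> f.
by rewrite permE hE.
Qed.

Lemma Aut_restrM :
  {in Aut_lattice T &, {morph Aut_restr : phi psi / (phi * psi)%g}}.
Proof.
move=> phi psi phiA psiA; apply/permP=> e; apply: is_Irr_inj.
by rewrite permM !Aut_restrE ?groupM // permM.
Qed.

Lemma Aut_restr_order (phi : {perm T}) :
  phi \in Aut_lattice T -> Aut_restr phi \in Aut_order R.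
Proof.
move=> phiA; apply/Aut_orderP=> e f.
by rewrite !irrE.1 !Aut_restrE // Aut_lattice_mono.
Qed.

End Irreducibles.

(* Main.v *)
Require Import Defs.
From HB Require Import structures.
From mathcomp Require Import all_boot all_order all_algebra all_fingroup.
From mathcomp Require Import boolp.

(* Pairing with k C(E, X) embeds S_{E,R}(X) in the k-valued functions on
   C(E, X), onto the k-span of the functions r |-> [Delta_E <= r F <= R] for
   F in C(X, E). Such a function depends only on the lower bounds of the sets
   F(x) and on which of them have a least element, so it is the function
   [vec g] of a profile g : X -> E + {set E}, where [inl e] stands for the
   principal down-set of e that must be met at e, and [inr B] for a down-set B
   without such an obligation. The inclusion-exclusion identity [vec_split]
   exchanges the down-sets [dn e] and [sdn e] as values of [inr], and this
   rewrites everything in terms of the profiles that hit every [inl e] and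
   whose [inr] values satisfy [free_lb]. These are linearly independent by a
   triangularity argument, so they form a k-basis. Every automorphism of (E, R)
   permutes it, and the identity is the only one with a fixed point, since
   all of E occurs in an admissible profile. Hence orbit representatives form
   a basis over the group algebra. *)

Set Implicit Arguments.
Unset Strict Implicit.
Unset Printing Implicit Defensive.

Import Order.TTheory GRing.Theory.

Local Open Scope ring_scope.

(** * Lower bounds, closed sets and principal down-sets in a finite poset *)

Section Poset.
Variables (E : finType) (R : order_on E).
Implicit Types (e f : E) (A B : {set E}).

Definition dn e : {set E} := [set f | (f, e) \in (R : corr E E)].
Definition sdn e : {set E} := dn e :\ e.
Definition lb A : {set E} :=
  [set f | [forall a in A, (f, a) \in (R : corr E E)]].
Definition ub B : {set E} :=
  [set f | [forall b in B, (b, f) \in (R : corr E E)]].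
Definition closedb B := lb (ub B) == B.

Lemma lbP A f :
  reflect (forall a, a \in A -> (f, a) \in (R : corr E E)) (f \in lb A).
Proof. by rewrite inE; apply: forall_inP. Qed.

Lemma ubP B f :
  reflect (forall b, b \in B -> (b, f) \in (R : corr E E)) (f \in ub B).
Proof. by rewrite inE; apply: forall_inP. Qed.

Lemma sub_lb_ub B : B \subset lb (ub B).
Proof. by apply/subsetP=> b bB; apply/lbP=> a /ubP/(_ _ bB). Qed.

Lemma lb_anti A A' : A \subset A' -> lb A' \subset lb A.
Proof.
move=> /subsetP sAA'; apply/subsetP=> f /lbP H.
by apply/lbP=> a /sAA'; apply: H.
Qed.

Lemma ub_anti B B' : B \subset B' -> ub B' \subset ub B.
Proof.
move=> /subsetP sBB'; apply/subsetP=> f /ubP H.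
by apply/ubP=> a /sBB'; apply: H.
Qed.

Lemma closedb_lb A : closedb (lb A).
Proof.
rewrite /closedb eqEsubset sub_lb_ub andbT; apply: lb_anti.
by apply/subsetP=> a aA; apply/ubP=> b /lbP; apply.
Qed.

Lemma mem_dn e : e \in dn e.
Proof. by rewrite inE order_refl. Qed.

Lemma lb_min A e : e \in A -> e \in lb A -> lb A = dn e.
Proof.
move=> eA /lbP elb; apply/setP=> f; apply/lbP/idP; rewrite inE; first exact.
by move=> fe a aA; apply: order_trans fe _; apply: elb.
Qed.

Lemma lb1 e : lb [set e] = dn e.
Proof.
apply: lb_min; rewrite ?set11 //.
by apply/lbP=> a /set1P ->; apply: order_refl.
Qed.

Lemma closedb_dn e : closedb (dn e).
Proof. by rewrite -lb1 closedb_lb. Qed.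

Lemma dn_inj : injective dn.
Proof.
move=> e f ef; have : f \in dn e by rewrite ef mem_dn.
have : e \in dn f by rewrite -ef mem_dn.
by rewrite !inE; apply: order_anti.
Qed.

Lemma card_dn e : #|dn e| = #|sdn e|.+1.
Proof. by rewrite (cardsD1 e) mem_dn. Qed.

(** The closure of [sdn e] lies between [sdn e] and [dn e], which differ by one point; being
    strictly larger than [sdn e], it is [dn e]. *)
Lemma closure_sdn e B :
  ~~ closedb (sdn e) -> closedb B -> sdn e \subset B -> dn e \subset B.
Proof.
move=> ncl /eqP cB sB.
have e_ub : e \in ub (sdn e) by apply/ubP=> b; rewrite !inE => /andP[].
have sub : lb (ub (sdn e)) \subset dn e by rewrite -[dn e]lb1 lb_anti // sub1set.
have s1 : lb (ub (sdn e)) \subset B by rewrite -cB lb_anti // ub_anti.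
apply: subset_trans s1; suff : e \in lb (ub (sdn e)).
  move=> eC; apply/subsetP=> f fe; have [->//|ne] := eqVneq f e.
  by apply: (subsetP (sub_lb_ub _)); rewrite !inE ne; rewrite inE in fe.
apply: contraR ncl => neC; rewrite /closedb eqEsubset sub_lb_ub andbT.
by rewrite subsetD1 sub.
Qed.

(** A common point of [A] and [lb A] is a least element of [A], so disjointness says that [A] has
    none. *)
Definition lb_nomin B : bool :=
  [exists A : {set E}, (lb A == B) && [disjoint A & lb A]].

(* When [dn e] is also the set of lower bounds of a set without least element,
   it occurs as a value of [inr]; [vec_split] then makes [sdn e] available too,
   which matters when [sdn e] is again principal. *)
Inductive reach : E -> Prop :=
| Reach0 e : lb_nomin (dn e) -> reach e
| ReachS e f : reach e -> sdn e = dn f -> reach f.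

Definition nonprincipal B := closedb B && [forall e, B != dn e].

(* A principal [dn e] is kept as a value of [inr] only if [sdn e] is not closed;
   otherwise [vec_split] eliminates it in favour of [sdn e]. *)
Definition free_lb B : bool :=
  nonprincipal B ||
  `[< exists e, [/\ B = dn e, reach e & ~~ closedb (sdn e)] >].

(** The domain of both reductions: upwards to [lb_nomin], where profiles come from correspondences,
    and downwards to [free_lb]. *)
Definition free_or_reach B : Prop :=
  nonprincipal B \/ exists2 e, reach e & B = dn e.

Lemma closedb_nonprincipal B :
  closedb B -> nonprincipal B \/ exists e, B = dn e.
Proof.
move=> cB; rewrite /nonprincipal cB /=; case: forallP => [|nH]; first by left.
by right; apply: contrapT => H; case: nH => e; apply/eqP => Be; case: H; exists e.
Qed.

Lemma lb_nomin_free_or_reach B : lb_nomin B -> free_or_reach B.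
Proof.
move=> H; have /existsP[A /andP[/eqP AB _]] := H.
have [|?|[e Be]] := @closedb_nonprincipal B; first by rewrite -AB closedb_lb.
  by left.
by right; exists e => //; apply: Reach0; rewrite -Be.
Qed.

(** The witness is [ub B]: a point of [B] in [ub B] would be a greatest element of [B] and make [B]
    principal. *)
Lemma nonprincipal_lb_nomin B : nonprincipal B -> lb_nomin B.
Proof.
case/andP=> /eqP cB /forallP np; apply/existsP; exists (ub B).
rewrite cB eqxx /= disjoint_subset; apply/subsetP=> e eU; rewrite inE.
apply/negP=> eB; have /eqP[] := np e.
by rewrite -{1}cB; apply: lb_min; rewrite ?cB.
Qed.

Lemma free_lb_closed B : free_lb B -> closedb B.
Proof. by case/orP=> [/andP[]//|/asboolP[e [-> _ _]]]; exact: closedb_dn. Qed.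

Lemma free_lb_dn e : free_lb (dn e) -> ~~ closedb (sdn e).
Proof.
case/orP=> [/andP[_ /forallP/(_ e)]|/asboolP[f [/dn_inj -> _ //]]].
by rewrite eqxx.
Qed.

Definition sdn_swap e B B' : Prop :=
  (B = dn e /\ B' = sdn e) \/ (B = sdn e /\ B' = dn e).

(** This undoes one step of [reach]: a principal [dn e] equal to some [sdn f] is exchanged for the
    larger [dn f]. *)
Lemma free_or_reach_up B : free_or_reach B ->
  lb_nomin B \/ exists e B', [/\ sdn_swap e B B', free_or_reach B'
                               & (#|E| - #|B'| < #|E| - #|B|)%N].
Proof.
case=> [/nonprincipal_lb_nomin|[e re ->]]; first by left.
case: re => [f|f {}e rf fe]; first by left.
right; exists f, (dn f); split; first by right.
  by right; exists f.
have lt : (#|sdn f| < #|dn f|)%N by rewrite card_dn.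
by rewrite -fe ltn_sub2l // (leq_trans lt) ?max_card.
Qed.

(** A closed [sdn e] is either nonprincipal or a principal down-set reached by [ReachS], so it may
    replace [dn e]. *)
Lemma free_or_reach_down B : free_or_reach B ->
  free_lb B \/ exists e B', [/\ sdn_swap e B B', free_or_reach B'
                               & (#|B'| < #|B|)%N].
Proof.
case=> [np|[e re ->]]; first by left; rewrite /free_lb np.
have [cl|ncl] := boolP (closedb (sdn e)); last first.
  by left; apply/orP; right; apply/asboolP; exists e.
right; exists e, (sdn e); split; [by left| |by rewrite card_dn].
have [?|[f ef]] := closedb_nonprincipal cl; first by left.
by right; exists f => //; apply: ReachS ef.
Qed.

End Poset.

(** * Profiles and the exchange of [dn e] and [sdn e] *)

Section Profiles.
Variables (E : finType) (R : order_on E) (X : finType).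
Implicit Types (g : {ffun X -> E + {set E}}) (h : X) (e : E) (B : {set E})
  (rho : X -> {set E}).

Definition bound (v : E + {set E}) : {set E} :=
  match v with inl e => dn R e | inr B => B end.

Definition corr_row (r : corr E X) (x : X) : {set E} := [set e | (e, x) \in r].

Lemma mem_corr_row (r : corr E X) e x : (e \in corr_row r x) = ((e, x) \in r).
Proof. exact: in_set. Qed.

Definition hits g (rho : X -> {set E}) : bool :=
  [forall x, rho x \subset bound (g x)] &&
  [forall e, exists x, (g x == inl e) && (e \in rho x)].

Lemma hitsP g rho :
  reflect ((forall x, rho x \subset bound (g x)) /\
           (forall e, exists2 x, g x = inl e & e \in rho x)) (hits g rho).
Proof.
apply: (iffP andP) => -[H1 H2]; split.
- exact/forallP.
- by move=> e; have /existsP[x /andP[/eqP]] := forallP H2 e; exists x.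
- exact/forallP.
- by apply/forallP=> e; apply/existsP; have [x gx ex] := H2 e; exists x; rewrite gx eqxx.
Qed.

Definition set_point g h e : {ffun X -> E + {set E}} :=
  [ffun x => if x == h then inl e else g x].

Definition swap_fibre g h e B : {ffun X -> E + {set E}} :=
  [ffun x => if x == h then inl e else if g x == inl e then inr B else g x].

Lemma sub_sdn (A : {set E}) e :
  (A \subset sdn R e) = (A \subset dn R e) && (e \notin A).
Proof. by rewrite subsetD1. Qed.

(* With P the fibre of g over [inl e], the case B = dn e is the identity
   u^h (u^P - v^P) = (u^{P+h} - v^{P+h}) - v^P (u^h - v^h) between products of
   indicators, u standing for [dn e] and v for [sdn e]; the case B = sdn e is
   the same identity with u and v exchanged, up to sign. *)
Lemma hits_split g h e B B' rho : sdn_swap R e B B' -> g h = inr B ->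
  hits (set_point g h e) rho =
    hits g rho || hits (swap_fibre g h e B') rho
  /\ ~~ (hits g rho && hits (swap_fibre g h e B') rho).
Proof.
move=> sw gh.
have nh x f : g x = inl f -> x == h = false.
  by move=> gx; apply/eqP=> xh; rewrite xh gh in gx.
have [sB sB'] : B \subset dn R e /\ B' \subset dn R e.
  by case: sw => -[-> ->]; rewrite ?subxx ?subD1set.
have in_sdn (A : {set E}) : A \subset sdn R e -> e \notin A.
  by rewrite sub_sdn => /andP[].
split; last first.
  (* The first condition puts [e] in a row over the fibre of [g], the second in the row at [h], the
     only point left over [inl e]; one of these rows is confined to [sdn e]. *)
  apply/negP=> /andP[/hitsP[H1 H2] /hitsP[K1 K2]].
  have [y gy ey] := H2 e; have [z gz ez] := K2 e.
  have zh : z = h.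
    apply/eqP; move: gz; rewrite ffunE; case: eqP => // _.
    by case: (g z =P inl e) => // ne gz; case: ne.
  subst z; case: sw => -[BE B'E].
    by have := K1 y; rewrite ffunE (nh y e) // gy eqxx B'E => /in_sdn/negP.
  by have := H1 h; rewrite gh BE => /in_sdn/negP.
apply/idP/orP => [/hitsP[H1 H2]|[/hitsP[H1 H2]|/hitsP[H1 H2]]].
- have Hx x : x != h -> rho x \subset bound (g x).
    by move=> /negPf xh; have := H1 x; rewrite ffunE xh.
  have Hh : rho h \subset dn R e by have := H1 h; rewrite ffunE eqxx.
  have He f : f != e -> exists2 x, g x = inl f & f \in rho x.
    move=> fe; have [x] := H2 f; rewrite ffunE; case: eqP => _; last by exists x.
    by case=> ef; rewrite ef eqxx in fe.
  have caseL : rho h \subset B ->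
      (exists2 x, g x = inl e & e \in rho x) -> hits g rho.
    move=> hB Hex; apply/hitsP; split=> [x|f].
      by have [->|/Hx//] := eqVneq x h; rewrite gh.
    by have [->//|/He] := eqVneq f e.
  have caseR : e \in rho h -> (forall x, g x = inl e -> rho x \subset B') ->
      hits (swap_fibre g h e B') rho.
    move=> eh HF; apply/hitsP; split=> [x|f].
      rewrite ffunE; have [->//|xh] := eqVneq x h.
      by case: (g x =P inl e) => [/HF|] // _; apply: Hx.
    have [->|fe] := eqVneq f e; first by exists h; rewrite // ffunE eqxx.
    have [x gx fx] := He f fe; exists x => //; rewrite ffunE (nh x f) // gx.
    by case: eqP => // -[ef]; rewrite ef eqxx in fe.
  (* If [B] is [dn e], the question is whether the old fibre meets [e]; if [B] is [sdn e], whether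
     the row at [h] contains [e]. *)
  have [y] := H2 e; rewrite ffunE; case: sw => -[BE B'E].
    have [[x gx ex] _ _|nF gy ey] :=
        pselect (exists2 x, g x = inl e & e \in rho x).
      by left; apply: caseL; [rewrite BE|exists x].
    right; apply: caseR => [|x gx].
      by move: gy ey; case: eqP => [-> //|_ gy ey]; case: nF; exists y.
    rewrite B'E sub_sdn; apply/andP; split; last by apply/negP=> ex; case: nF; exists x.
    by have := Hx x; rewrite gx; apply; rewrite (nh x e).
  have [eh _ _|neh] := boolP (e \in rho h).
    right; apply: caseR => // x gx; rewrite B'E.
    by have := Hx x; rewrite gx; apply; rewrite (nh x e).
  case: eqP => [-> _|_ gy ey]; first by rewrite (negPf neh).
  by left; apply: caseL; [rewrite BE sub_sdn Hh|exists y].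
- apply/hitsP; split=> [x|f].
    rewrite ffunE; have [->|//] := eqVneq x h.
    by apply: subset_trans (H1 h) _; rewrite gh.
  by have [x gx fx] := H2 f; exists x; rewrite // ffunE (nh x f).
- apply/hitsP; split=> [x|f].
    have := H1 x; rewrite !ffunE; case: eqP => // _.
    by case: eqP => // -> /subset_trans; apply.
  have [x gx fx] := H2 f; exists x => //; move: gx; rewrite !ffunE.
  by case: eqP => // _; case: eqP.
Qed.

End Profiles.

(** * The functions [vec g] and their reduction to admissible profiles *)

Section ProfileVectors.
Variables (k : comPzRingType) (E : finType) (R : order_on E) (X : finType).
Implicit Types (g : {ffun X -> E + {set E}}) (h : X) (e : E) (B : {set E}).

Definition vec g : {ffun corr E X -> k} := [ffun r => (hits R g (corr_row r))%:R].

Lemma vec_split g h e B B' : sdn_swap R e B B' -> g h = inr B ->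
  vec g = vec (set_point g h e) - vec (swap_fibre g h e B').
Proof.
move=> sw gh; apply/ffunP=> r; rewrite !ffunE.
have [-> ] := hits_split (corr_row r) sw gh.
case: (hits R g _); case: (hits R _ _) => //= _;
  by rewrite ?subr0 ?subrr // sub0r.
Qed.

Definition inr_values (P : {set E} -> Prop) g : Prop :=
  forall x B, g x = inr B -> P B.

(* Replacing one bad value by at most #|X| values of lower level decreases the
   sum of the weights (#|X| + 1) ^ lvl. *)
Lemma vec_reduce (S : {ffun corr E X -> k} -> Prop) (W good : {set E} -> Prop)
    (lvl : {set E} -> nat) :
  (forall u v, S u -> S v -> S (u - v)) ->
  (forall g, inr_values good g -> S (vec g)) ->
  (forall B, W B -> good B \/
     exists e B', [/\ sdn_swap R e B B', W B' & (lvl B' < lvl B)%N]) ->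
  forall g, inr_values W g -> S (vec g).
Proof.
move=> SB Sgood Wred.
pose wt (v : E + {set E}) := if v is inr B then (#|X|.+1 ^ lvl B)%N else 0%N.
move=> g; move: {2}_.+1 (ltnSn (\sum_x wt (g x)))%N => n.
elim: n g => // n IHn g; rewrite ltnS => le_n Wg.
have [/Sgood //|nG] := pselect (inr_values good g).
have [h [B [gh nB]]] : exists h B, g h = inr B /\ ~ good B.
  apply: contrapT => H; apply: nG => x B gx; apply: contrapT => nB.
  by apply: H; exists x, B.
have [//|[e [B' [sw WB' ltB]]]] := Wred B (Wg h B gh).
have small g' : inr_values W g' -> wt (g' h) = 0%N ->
    (forall x, x != h -> (wt (g' x) <= wt (g x) + #|X|.+1 ^ lvl B')%N) ->
    S (vec g').
  move=> Wg' g'h le_wt; apply: IHn => //; apply: leq_trans le_n.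
  rewrite (bigD1 h) //= [ltnRHS](bigD1 h) //= g'h add0n gh /=.
  apply: (@leq_ltn_trans (\sum_(x | x != h) (wt (g x) + #|X|.+1 ^ lvl B'))%N).
    exact: leq_sum.
  rewrite big_split /= addnC ltn_add2r sum_nat_const.
  apply: (@leq_ltn_trans (#|X| * #|X|.+1 ^ lvl B')%N).
    by rewrite leq_mul2r max_card orbT.
  apply: (@leq_trans (#|X|.+1 ^ (lvl B').+1)%N); last by rewrite leq_pexp2l.
  by rewrite expnS ltn_mul2r expn_gt0 ltnSn.
rewrite (vec_split sw gh); apply: SB; apply: small.
- by move=> x A; rewrite ffunE; case: eqP => // _; apply: Wg.
- by rewrite ffunE eqxx.
- by move=> x /negPf xh; rewrite ffunE xh leq_addr.
- move=> x A; rewrite ffunE; case: eqP => // _.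
  by case: eqP => [_ [<-]|_ /Wg].
- by rewrite ffunE eqxx.
move=> x /negPf xh; rewrite ffunE xh; case: eqP => _; last exact: leq_addr.
by rewrite leq_addl.
Qed.

Definition admissible g : bool :=
  [forall x, if g x is inr B then free_lb R B else true] &&
  [forall e, exists x, g x == inl e].

Lemma admissibleP g :
  reflect (inr_values (free_lb R) g /\ forall e, exists x, g x = inl e)
          (admissible g).
Proof.
apply: (iffP andP) => -[H1 H2]; split.
- by move=> x B gx; have := forallP H1 x; rewrite gx.
- by move=> e; have /existsP[x /eqP] := forallP H2 e; exists x.
- by apply/forallP=> x; case gx: (g x) => [//|B]; apply: H1 gx.
- by apply/forallP=> e; apply/existsP; have [x gx] := H2 e; exists x; rewrite gx.
Qed.

Lemma vec_admissible0 g :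
  inr_values (free_lb R) g -> ~~ admissible g -> vec g = 0.
Proof.
move=> Hg nadm; apply/ffunP=> r; rewrite !ffunE.
suff /negPf -> : ~~ hits R g (corr_row r) by [].
apply/negP=> /hitsP[_ H]; case/negP: nadm; apply/admissibleP; split=> // e.
by have [x] := H e; exists x.
Qed.

(** The downward reduction, with cardinality as level; the non-admissible profiles left at the end
    have zero vector. *)
Lemma vec_span g : inr_values (free_or_reach R) g ->
  exists c : {ffun X -> E + {set E}} -> k,
    forall r, vec g r = \sum_(a | admissible a) c a * vec a r.
Proof.
move: g; apply: (@vec_reduce (fun u => exists c : {ffun X -> E + {set E}} -> k,
  forall r, u r = \sum_(a | admissible a) c a * vec a r)
  _ (free_lb R) (fun B => #|B|)); last exact: free_or_reach_down.
  move=> u v [c Hc] [c' Hc']; exists (fun a => c a - c' a) => r.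
  rewrite !ffunE Hc Hc' -sumrB; by apply: eq_bigr => a _; rewrite mulrBl.
move=> g Hg; have [ag|nag] := boolP (admissible g); last first.
  exists (fun=> 0) => r; rewrite vec_admissible0 // ffunE big1 // => a _.
  by rewrite mul0r.
exists (fun a => (a == g)%:R) => r.
rewrite (bigD1 g) //= eqxx mul1r big1 ?addr0 // => a /andP[_ /negPf ->].
by rewrite mul0r.
Qed.

End ProfileVectors.

(** * Linear independence of the admissible vectors *)

Section Independence.
Variables (k : comPzRingType) (E : finType) (R : order_on E) (X : finType).
Implicit Types (g a : {ffun X -> E + {set E}}) (e : E) (D : {set E}).

Definition test_set g D x : {set E} :=
  match g x with
  | inl e => if e \in D then sdn R e else dn R e
  | inr B => B
  end.

Definition test_corr g D : corr E X := [set p | p.1 \in test_set g D p.2].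

Lemma corr_row_test g D x : corr_row (test_corr g D) x = test_set g D x.
Proof. by apply/setP=> e; rewrite !inE. Qed.

(* [test_form] sums over sets D of elements e with [sdn e] not closed: the sign
   vanishes on the other D. For such e, the relevant matrix on fibres is
   [F meets F'], which this inclusion-exclusion makes triangular. *)
Definition test_sign D : k :=
  \prod_e (if e \in D then (if closedb R (sdn R e) then 0 else -1) else 1).

Definition test_form g a : k :=
  \sum_D test_sign D * vec k R a (test_corr g D).

Lemma test_sign0 D e : e \in D -> closedb R (sdn R e) -> test_sign D = 0.
Proof. by move=> eD cl; rewrite /test_sign (bigD1 e) //= eD cl mul0r. Qed.

Lemma bound_closed a x : admissible R a -> closedb R (bound R (a x)).
Proof.
move=> /admissibleP[H _]; case ax: (a x) => [e|B] /=; first exact: closedb_dn.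
exact/free_lb_closed/(H x).
Qed.

Lemma test_set_sub g D x : test_set g D x \subset bound R (g x).
Proof.
by rewrite /test_set; case: (g x) => [e|B] //=; case: ifP; rewrite ?subD1set.
Qed.

(** The bounds of an admissible profile are closed, and a non-closed [sdn e] has closure [dn e], so
    deleting [e] from a row does not weaken the inclusion. *)
Lemma hits_test_sub g a D : admissible R a ->
  {in D, forall e, ~~ closedb R (sdn R e)} ->
  hits R a (corr_row (test_corr g D)) ->
  forall x, bound R (g x) \subset bound R (a x).
Proof.
move=> adm_a Dcl /hitsP[H _] x; have := H x; rewrite corr_row_test /test_set.
case: (g x) => [e|B] //=; case: ifP => // /Dcl ncl.
exact: closure_sdn ncl (bound_closed x adm_a).
Qed.

Definition fibre_spill g a e : bool :=
  [exists x, (a x == inl e) && (g x != inl e)].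

(** With equal bounds only the obligations matter. For [e] in [D], the point [e] survives on the
    fibre of [a] exactly where [g] is not [inl e], hence is [inr (dn R e)]. *)
Lemma hits_test_eq g a D : admissible R a ->
  (forall x, bound R (g x) = bound R (a x)) ->
  hits R a (corr_row (test_corr g D)) = [forall e in D, fibre_spill g a e].
Proof.
move=> /admissibleP[_ hit_a] eq_b; apply/hitsP/forall_inP => [[_ H] e eD|H].
  have [x ax] := H e; rewrite corr_row_test /test_set => ex.
  apply/existsP; exists x; rewrite ax eqxx; apply/eqP=> gx.
  by rewrite gx eD !inE eqxx in ex.
split=> [x|e].
  by rewrite corr_row_test -eq_b test_set_sub.
have [eD|eD] := boolP (e \in D).
  have /existsP[x /andP[/eqP ax gx]] := H e eD; exists x => //.
  rewrite corr_row_test /test_set; have := eq_b x; rewrite ax.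
  by case: (g x) gx => [f /eqP nf /dn_inj ef|B _ /= ->]; [rewrite ef in nf|exact: mem_dn].
have [x ax] := hit_a e; exists x => //.
rewrite corr_row_test /test_set; have := eq_b x; rewrite ax.
case: (g x) => [f /dn_inj ->|B /= ->]; last exact: mem_dn.
by rewrite (negPf eD) mem_dn.
Qed.

(** Sign and hit indicator are both products over [e], so the sum over [D] expands a product. Its
    factor is 1 if [sdn e] is closed, and otherwise indicates that the fibre of [a] over [inl e]
    lies in that of [g]. *)
Lemma test_form_eq g a : admissible R a ->
  (forall x, bound R (g x) = bound R (a x)) ->
  test_form g a =
    \prod_e ((if closedb R (sdn R e) then 0 else -1) * (fibre_spill g a e)%:R + 1).
Proof.
move=> adm_a eq_b; rewrite bigA_distr; apply: eq_bigr => D _.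
rewrite ffunE hits_test_eq // /test_sign.
have -> : ([forall e in D, fibre_spill g a e]%:R : k) =
    \prod_e (if e \in D then (fibre_spill g a e)%:R else 1).
  case: forall_inP => [H|nH].
    by rewrite big1 // => e _; case: ifP => // /H ->.
  have [e eD /negPf ne] : exists2 e, e \in D & ~~ fibre_spill g a e.
    apply: contrapT => H; apply: nH => e eD; apply: contrapT => /negP ne.
    by apply: H; exists e.
  by rewrite (bigD1 e) //= eD ne mul0r.
rewrite -big_split /=; apply: eq_bigr => e _; case: ifP => // _; exact: mulr1.
Qed.

Lemma test_form_refl g : admissible R g -> test_form g g = 1.
Proof.
move=> adm; rewrite test_form_eq // big1 // => e _.
rewrite /fibre_spill; have -> : [exists x, (g x == inl e) && (g x != inl e)] = false.
  by apply/existsP=> -[x]; rewrite andbN.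
by rewrite mulr0 add0r.
Qed.

(* The second term only breaks ties between profiles with the same bounds. *)
Definition weight g : nat :=
  (#|X|.+1 * (\sum_x #|bound R (g x)|) +
   \sum_x (if g x is inr _ then 1 else 0))%N.

(** A nonzero term forces the bounds of [g] into those of [a]. If all bounds agree, the nonzero
    product puts each fibre of [a] inside that of [g], so [a] has more [inr] values unless
    [a = g]. *)
Lemma test_form_weight g a : admissible R g -> admissible R a ->
  test_form g a != 0 -> a = g \/ (weight g < weight a)%N.
Proof.
move=> adm_g adm_a ne0.
have le_b x : bound R (g x) \subset bound R (a x).
  have [D] : exists D, test_sign D * vec k R a (test_corr g D) != 0.
    apply: contrapT => H; case/eqP: ne0; apply: big1 => D _.
    by apply: contrapT => /eqP ne; apply: H; exists D.
  rewrite ffunE; case hD: (hits _ _ _); last by rewrite mulr0 eqxx.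
  rewrite mulr1 => sD; apply: (hits_test_sub adm_a) hD x => e eD.
  by apply: contra sD => /(test_sign0 eD) ->.
have [eq_b|] := pselect (forall x, bound R (g x) = bound R (a x)); last first.
  move=> neq; right; have [y lt_y] : exists y, (#|bound R (g y)| < #|bound R (a y)|)%N.
    apply: contrapT => H; apply: neq => x; apply/eqP; rewrite eqEcard le_b /=.
    by rewrite leqNgt; apply/negP=> lt; apply: H; exists x.
  rewrite /weight; set s := (\sum_x #|bound R (g x)|)%N.
  set s' := (\sum_x #|bound R (a x)|)%N.
  have lt_s : (s < s')%N.
    rewrite /s /s' (bigD1 y) //= [ltnRHS](bigD1 y) //= -addSn.
    by apply: leq_add => //; apply: leq_sum => x _; apply: subset_leq_card.
  apply: leq_trans (leq_addr _ _); apply: (@leq_trans (#|X|.+1 * s.+1)%N).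
    rewrite mulnS addnC ltn_add2r ltnS.
    apply: (@leq_trans (\sum_(x : X) 1)%N); last by rewrite sum1_card.
    by apply: leq_sum => x _; case: (g x).
  by rewrite leq_mul2l lt_s orbT.
have sub x e : a x = inl e -> g x = inl e.
  move=> ax; apply/eqP; apply: contraR ne0 => gx.
  (* Here [g x] must be [inr (dn R e)]; [free_lb] then makes [sdn e] non-closed, and the factor at
     [e] is [-1 + 1]. *)
  have sp : fibre_spill g a e by apply/existsP; exists x; rewrite ax eqxx.
  have ncl : ~~ closedb R (sdn R e).
    have := eq_b x; rewrite ax /=; case gE: (g x) gx => [f|B] /=.
      by move=> /eqP nf /dn_inj ef; rewrite ef in nf.
    move=> _ BE; apply: free_lb_dn; rewrite -BE.
    by have /admissibleP[H _] := adm_g; apply: H gE.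
  by rewrite test_form_eq // (bigD1 e) //= sp (negPf ncl) mulr1 addNr mul0r eqxx.
have [->|ne] := eqVneq a g; [by left|right].
have [y ya] : exists y, a y != g y.
  apply: contrapT => H; case/eqP: ne; apply/ffunP=> x; apply: contrapT => /eqP nx.
  by apply: H; exists x.
rewrite /weight.
have -> : (\sum_x #|bound R (g x)| = \sum_x #|bound R (a x)|)%N.
  by apply: eq_bigr => x _; rewrite eq_b.
rewrite ltn_add2l (bigD1 y) //= [ltnRHS](bigD1 y) //= -addSn; apply: leq_add.
  have := eq_b y; case aE: (a y) ya => [e|B]; first by rewrite (sub _ _ aE) eqxx.
  by case: (g y) => [f //|B'] /= nB BE; rewrite BE eqxx in nB.
apply: leq_sum => x _; case aE: (a x) => [e|B]; first by rewrite (sub _ _ aE).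
by case: (g x).
Qed.

(** For [g] of maximal weight among the profiles with nonzero coefficient, applying [test_form g] to
    the relation leaves [c g] times 1, so no division in [k] occurs. *)
Lemma vec_indep (c : {ffun X -> E + {set E}} -> k) :
  (forall r, \sum_(a | admissible R a) c a * vec k R a r = 0) ->
  forall a, admissible R a -> c a = 0.
Proof.
move=> H a0 adm0; apply/eqP; apply: contraT => ne0.
have P0 : (admissible R a0) && (c a0 != 0) by rewrite adm0.
pose P := [pred g | admissible R g && (c g != 0)].
case: (@arg_maxnP _ a0 P weight P0) => g /andP[adm_g ne_g] max_g.
suff : c g = 0 by move/eqP; rewrite (negPf ne_g).
transitivity (\sum_(a | admissible R a) c a * test_form g a).
  rewrite (bigD1 g) //= test_form_refl // mulr1 big1 ?addr0 // => a /andP[adm_a ne_a].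
  have [->|ca] := eqVneq (c a) 0; first by rewrite mul0r.
  have [->|/(test_form_weight adm_g adm_a)[ag|lt]] := eqVneq (test_form g a) 0.
  - exact: mulr0.
  - by rewrite ag eqxx in ne_a.
  - by have := max_g a; rewrite /= adm_a ca leqNgt lt => /(_ isT).
under eq_bigr => a _ do rewrite mulr_sumr.
rewrite exchange_big big1 //= => D _.
transitivity (test_sign D *
    \sum_(a | admissible R a) c a * vec k R a (test_corr g D)).
  by rewrite mulr_sumr; apply: eq_bigr => a _; rewrite mulrCA.
by rewrite H mulr0.
Qed.

End Independence.

(** * The pairing that embeds the evaluation in a space of functions *)

Section Pairing.
Variables (k : comPzRingType) (E : finType) (R : order_on E) (X : finType).
Local Notation fmod := (fund_mod k R).
Implicit Types (r : corr E X) (phi : kcorr_rmod k X E) (w : fmod).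

Definition coef w (a : {perm E}) : k := (w : {ffun {perm E} -> k}) a.

Lemma coefD w w' a : coef (w + w') a = coef w a + coef w' a.
Proof. exact: ffunE. Qed.

Lemma coef_sum (I : Type) (s : seq I) (F : I -> fmod) a :
  coef (\sum_(i <- s) F i) a = \sum_(i <- s) coef (F i) a.
Proof.
elim: s => [|i s IH]; first by rewrite !big_nil [LHS]ffunE.
by rewrite !big_cons coefD IH.
Qed.

Definition act_by (rho : kcorr k E X) phi w : fmod :=
  (kcomp rho phi : kcorr_alg k E) *: w.

(** The coefficient at the identity suffices: [coef_act_by] recovers the others by composing [r]
    with a permutation. *)
Definition pairing phi w : {ffun corr E X -> k} :=
  [ffun r => coef (act_by (delta k r) phi w) 1%g].

Lemma pairingDl phi phi' w :
  pairing (phi + phi') w = pairing phi w + pairing phi' w.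
Proof.
apply/ffunP=> r; rewrite !ffunE -coefD; congr (coef _ _).
by rewrite /act_by /kcomp bilinDr [LHS]scalerDl.
Qed.

Lemma pairingDr phi w w' :
  pairing phi (w + w') = pairing phi w + pairing phi w'.
Proof. by apply/ffunP=> r; rewrite !ffunE -coefD /act_by scalerDr. Qed.

Lemma pairingZ (x : kcorr_alg k E) phi w :
  pairing ((x : (kcorr_alg k E)^c) *: phi) w = pairing phi (x *: w).
Proof.
apply/ffunP=> r; rewrite !ffunE; congr (coef _ _).
rewrite /act_by scalerA; congr (_ *: _); exact: kcompA.
Qed.

Definition L_pairing (x : L_eval fmod X) : {ffun corr E X -> k} :=
  tensor_lift pairing x.

Lemma L_pairingB : zmod_morphism L_pairing.
Proof. exact: (tensor_liftB pairingDl pairingDr pairingZ). Qed.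

HB.instance Definition _ :=
  GRing.isZmodMorphism.Build (L_eval fmod X) {ffun corr E X -> k}
    L_pairing L_pairingB.

Lemma L_pairing_tens phi w : L_pairing (tens phi w) = pairing phi w.
Proof. exact: (tensor_lift_tens pairingDl pairingDr pairingZ). Qed.

Lemma L_pairing_J x : x \in @J_pred k E fmod X -> L_pairing x = 0.
Proof.
move=> /asboolP[s [-> Hs]]; rewrite raddf_sum; apply/ffunP=> r.
rewrite sum_ffunE [RHS]ffunE.
transitivity (coef (0 : fmod) 1%g); last exact: ffunE.
rewrite -(Hs (delta k r)) coef_sum.
by apply: eq_bigr => p _; rewrite /= L_pairing_tens ffunE.
Qed.

Definition eval_pairing (x : fund_eval k R X) : {ffun corr E X -> k} :=
  L_pairing (generic_quotient.repr x).

Lemma eval_pairing_class x : eval_pairing (LJ_class x) = L_pairing x.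
Proof.
apply/eqP; rewrite -subr_eq0 -raddfB; apply/eqP/L_pairing_J/LJ_classP.
exact: generic_quotient.reprK.
Qed.

Lemma eval_pairingB : zmod_morphism eval_pairing.
Proof.
elim/quotW=> x; elim/quotW=> y.
by rewrite -!/(LJ_class _) -raddfB !eval_pairing_class raddfB.
Qed.

HB.instance Definition _ :=
  GRing.isZmodMorphism.Build (fund_eval k R X) {ffun corr E X -> k}
    eval_pairing eval_pairingB.

Lemma eval_pairing_tens phi w : eval_pairing (LJ_tens phi w) = pairing phi w.
Proof. by rewrite eval_pairing_class L_pairing_tens. Qed.

Lemma fund_act_perm (u a : {perm E}) :
  fund_act k R (corr_perm u) a = delta k (Defs.pcomp u a).
Proof.
apply: fund_actE; apply/fund_condP; split=> [e|e f].
  by apply/imsetP; exists e.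
by case/imsetP=> x _ [/perm_inj -> ->]; apply: order_refl.
Qed.

Lemma coef_perm (u : {perm E}) w a :
  coef ((delta k (corr_perm u) : kcorr_alg k E) *: w) a = coef w (a * u^-1)%g.
Proof.
rewrite /coef [LHS]bilin_deltal -[RHS](sum_deltal (a * u^-1)%g).
apply: eq_bigr => b _; rewrite fund_act_perm !ffunE mulrC; congr (_ * _).
by rewrite eq_sym (can2_eq (mulgK u) (mulgKV u)).
Qed.

Lemma act_by_perm (u : {perm E}) r phi w :
  act_by (delta k (corr_comp (corr_perm u) r)) phi w =
  (delta k (corr_perm u) : kcorr_alg k E) *: act_by (delta k r) phi w.
Proof.
rewrite /act_by scalerA; congr (_ *: _).
transitivity (kcomp (kcomp (delta k (corr_perm u)) (delta k r)) phi).
  by rewrite /kcomp bilin_delta.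
by rewrite -kcompA.
Qed.

Lemma coef_act_by r phi w a :
  coef (act_by (delta k r) phi w) a =
  pairing phi w (corr_comp (corr_perm a^-1) r).
Proof. by rewrite ffunE act_by_perm coef_perm invgK mul1g. Qed.

Lemma coef_act_by_sum (rho : kcorr k E X) phi w a :
  coef (act_by rho phi w) a =
  \sum_r rho r * coef (act_by (delta k r) phi w) a.
Proof.
rewrite [LHS]ffunE.
have E1 Q : (kcomp rho phi) Q = \sum_r rho r * (kcomp (delta k r) phi) Q.
  rewrite [LHS]ffunE; apply: eq_bigr => r _; rewrite bilin_deltal mulr_sumr.
  by apply: eq_bigr => F _; rewrite mulrA.
under eq_bigr => Q _.
  rewrite E1; under eq_bigr => b _ do rewrite !mulr_suml.
  rewrite exchange_big /=; over.
rewrite exchange_big /=; apply: eq_bigr => r _.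
rewrite [coef _ _]ffunE mulr_sumr; apply: eq_bigr => Q _.
rewrite mulr_sumr; apply: eq_bigr => b _.
by rewrite !mulrA.
Qed.

(** Membership in J is the vanishing of all coefficients of [act_by rho]; by linearity in [rho] and
    [coef_act_by] these are combinations of values of the pairing. *)
Lemma eval_pairing_inj : injective eval_pairing.
Proof.
apply: raddf_inj => x; elim/quotW: x => y; rewrite -!/(LJ_class _).
have [s ->] := tensor_sum y; rewrite /= eval_pairing_class => H.
rewrite -[RHS](raddf0 (@LJ_class k E fmod X)); apply/LJ_classP; rewrite subr0.
apply/asboolP; exists s; split=> // rho; apply/ffunP=> a.
rewrite -!/(coef _ a) coef_sum [RHS]ffunE.
under eq_bigr => p _ do rewrite -/(act_by _ _ _) coef_act_by_sum.
rewrite exchange_big big1 //= => r _; rewrite -mulr_sumr.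
under eq_bigr => p _ do rewrite coef_act_by -L_pairing_tens.
rewrite -sum_ffunE; move: H; rewrite raddf_sum /= => ->.
by rewrite ffunE mulr0.
Qed.

End Pairing.

(** * The image of the pairing *)

Section Image.
Variables (k : comPzRingType) (E : finType) (R : order_on E) (X : finType).
Implicit Types (r : corr E X) (F : corr X E) (a : {perm E}).
Local Notation psi := (@eval_pairing k E R X).

Definition is_profile (A : X -> {set E}) (g : {ffun X -> E + {set E}}) : Prop :=
  forall x, bound R (g x) = lb R (A x) /\
    forall e, (g x == inl e) = (e \in A x) && (e \in lb R (A x)).

Lemma ex_profile (A : X -> {set E}) :
  exists2 g, is_profile A g & inr_values (lb_nomin R) g.
Proof.
exists [ffun x => if [pick e in A x | e \in lb R (A x)] is Some e
                  then inl e else inr (lb R (A x))].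
  move=> x; rewrite ffunE; case: pickP => [e /andP[eA elb]|none]; last first.
    by split=> // e; have := none e; rewrite /= => ->.
  have lbE := lb_min eA elb; split; first by rewrite lbE.
  move=> f; apply/eqP/andP => [[<-] //|[fA flb]].
  by congr inl; apply/(@dn_inj _ R); rewrite -lbE (lb_min fA flb).
move=> x B; rewrite ffunE; case: pickP => // none [<-].
apply/existsP; exists (A x); rewrite eqxx /= disjoint_subset.
by apply/subsetP=> e eA; rewrite inE; have := none e; rewrite /= eA /= => ->.
Qed.

(** Renaming the targets of [F] by [a] reduces to [a = 1]. A point [x] joining [e] to itself has [e]
    in its set and, by the upper inclusion, below all of that set; so [e] is its least element and
    [g x] is [inl e]. *)
Lemma fund_cond_hits r F a g :
  is_profile (fun x => [set e | (x, a e) \in F]) g ->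
  fund_cond R (corr_comp r F) a a^-1 = hits R g (corr_row r).
Proof.
move=> gP; apply/fund_condP/hitsP => -[H1 H2].
  split=> [x|e].
    have [-> _] := gP x; apply/subsetP=> e; rewrite inE => ex.
    apply/lbP=> f; rewrite inE => xf.
    have := H2 (a e) (a f); rewrite !permK; apply.
    by apply/in_corr_comp; exists x.
  have /in_corr_comp[x ex xe] := H1 (a e); rewrite permK in ex.
  exists x; last by rewrite inE.
  apply/eqP; have [_ ->] := gP x; rewrite inE xe; apply/lbP=> f; rewrite inE => xf.
  have := H2 (a e) (a f); rewrite !permK; apply.
  by apply/in_corr_comp; exists x.
split=> [e|e f /in_corr_comp[x ex xf]].
  have [x /eqP gx ex] := H2 (a^-1 e)%g; apply/in_corr_comp.
  move: gx ex; have [_ ->] := gP x; rewrite !inE permKV => /andP[xe _] ex.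
  by exists x.
have := H1 x; have [-> _] := gP x => /subsetP/(_ (a^-1 e)%g).
by rewrite inE => /(_ ex)/lbP; apply; rewrite inE permKV.
Qed.

Lemma fund_act_coef (Q : corr E E) a :
  fund_act k R Q a 1%g = (fund_cond R Q a a^-1)%:R.
Proof.
case: fund_actP => [b Hb|H0]; last by rewrite ffunE (negPf (H0 _)).
rewrite ffunE /Defs.pcomp; congr (_ %:R); congr nat_of_bool.
apply/eqP/idP => [/esym/(canRL (mulKg a))|Ha].
  by rewrite mulg1 => <-.
by rewrite (fund_cond_uniq Hb Ha) mulgV.
Qed.

Lemma pairingE phi (w : fund_mod k R) r :
  pairing phi w r = \sum_F \sum_a phi F * coef w a *
    (fund_cond R (corr_comp r F) a a^-1)%:R.
Proof.
rewrite ffunE [LHS]ffunE.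
under eq_bigr => Q _.
  rewrite bilin_deltal; under eq_bigr => a _ do rewrite !mulr_suml.
  rewrite exchange_big /=; over.
rewrite exchange_big /=; apply: eq_bigr => F _.
rewrite exchange_big /=; apply: eq_bigr => a _.
rewrite -fund_act_coef -[X in _ = _ * X](sum_deltal (corr_comp r F)
  (fun Q => fund_act k R Q a 1%g)) mulr_sumr.
by apply: eq_bigr => Q _; rewrite mulrA; congr (_ * _); rewrite mulrAC.
Qed.

(** A singleton realises [inl e], and the set without least element given by [lb_nomin] realises
    [inr B]; the resulting [F] is tensored with the generator [f_R]. *)
Lemma psi_profile g : inr_values (lb_nomin R) g ->
  exists m, psi m = vec k R g.
Proof.
move=> Hg.
have /fin_all_exists[A AP] x : exists A : {set E}, bound R (g x) = lb R A /\
    forall e, (g x == inl e) = (e \in A) && (e \in lb R A).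
  case gx: (g x) => [e|B] /=.
    exists [set e]; split=> [|f]; first by rewrite lb1.
    rewrite lb1 inE; apply/eqP/andP => [[<-]|[/eqP -> //]].
    by rewrite eqxx mem_dn.
  have /existsP[A /andP[/eqP AB dis]] := Hg x B gx; exists A; split=> // e.
  rewrite -AB; case: (boolP (e \in A)) => //= eA.
  by rewrite (disjointFr dis eA).
pose F : corr X E := [set p | p.2 \in A p.1].
exists (LJ_tens (delta k F : kcorr_rmod k X E) (delta k 1%g : fund_mod k R)).
rewrite eval_pairing_tens; apply/ffunP=> r; rewrite [LHS]pairingE [RHS]ffunE.
rewrite (bigD1 F) //= [X in _ + X]big1 ?addr0; last first.
  by move=> F' /negPf nF; rewrite big1 // => a _; rewrite ffunE nF !mul0r.
rewrite (bigD1 1%g) //= [X in _ + X]big1 ?addr0; last first.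
  by move=> a /negPf na; rewrite /coef ffunE [X in _ * X * _]ffunE na mulr0 mul0r.
rewrite /coef ffunE [X in _ * X * _]ffunE !eqxx !mul1r.
congr (_%:R); congr nat_of_bool; apply: fund_cond_hits => x.
by have [-> AE] := AP x; have -> : [set e | (x, (1%g : {perm E}) e) \in F] = A x
  by apply/setP=> e; rewrite !inE perm1.
Qed.

(** The image of [psi] is a subgroup, so the upward reduction applies to it. *)
Lemma psi_vec g : inr_values (free_or_reach R) g ->
  exists m, psi m = vec k R g.
Proof.
move: g; apply: (@vec_reduce k E R X (fun u => exists m, psi m = u)
    _ (lb_nomin R) (fun B => #|E| - #|B|)%N).
- by move=> _ _ [m <-] [m' <-]; exists (m - m'); rewrite raddfB.
- exact: psi_profile.
- exact: free_or_reach_up.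
Qed.

Lemma psi_span m : exists c : {ffun X -> E + {set E}} -> k,
  forall r, psi m r = \sum_(g | admissible R g) c g * vec k R g r.
Proof.
pose Sp (u : corr E X -> k) := exists c : {ffun X -> E + {set E}} -> k,
  forall r, u r = \sum_(g | admissible R g) c g * vec k R g r.
have Sp_sum (I : Type) (s : seq I) (u : I -> corr E X -> k) :
    (forall i, Sp (u i)) -> Sp (fun r => \sum_(i <- s) u i r).
  move=> Hu; have [c Hc] := choice Hu.
  exists (fun g => \sum_(i <- s) c i g) => r.
  under eq_bigr => i _ do rewrite Hc.
  by rewrite exchange_big /=; apply: eq_bigr => g _; rewrite mulr_suml.
have [s ->] := LJ_sum m; rewrite -/(Sp _).
have -> : psi (\sum_(p <- s) LJ_tens p.1 p.2) =
    (fun r => \sum_(p <- s) pairing p.1 p.2 r) :> (corr E X -> k).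
  apply: funext => r; rewrite raddf_sum sum_ffunE.
  by apply: eq_bigr => p _ /=; rewrite eval_pairing_tens.
apply: (Sp_sum) => p.
have -> : pairing p.1 p.2 = (fun r => \sum_F \sum_a p.1 F * coef p.2 a *
    (fund_cond R (corr_comp r F) a a^-1)%:R) :> (corr E X -> k).
  by apply: funext => r; rewrite pairingE.
apply: (Sp_sum) => F; apply: (Sp_sum) => a.
have [g gP gv] := ex_profile (fun x => [set e | (x, a e) \in F]).
have gfr : inr_values (free_or_reach R) g.
  by move=> x B /gv; apply: lb_nomin_free_or_reach.
have [c Hc] := vec_span k gfr.
exists (fun h => p.1 F * coef p.2 a * c h) => r.
rewrite (fund_cond_hits r gP).
under eq_bigr => h _ do rewrite -mulrA.
by rewrite -mulr_sumr -Hc ffunE.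
Qed.

End Image.

(** * The right action seen through the pairing *)

Section RightAction.
Variables (k : comPzRingType) (E : finType) (R : order_on E) (X : finType).
Variables (G : {group {perm E}}) (sGR : G \subset Aut_order R).

(** The right action commutes with [act_by], and the identity coefficient after acting by [u] is the
    coefficient at the inverse of [u] before. *)
Lemma eval_pairing_rscale (t : (kgroup_alg k G)^c)
    (m : fund_rmod k R sGR X) (r : corr E X) :
  eval_pairing (t *: m) r =
  \sum_(u : subg_of G) t u * eval_pairing m (corr_comp (corr_perm (sgval u)) r).
Proof.
have [s ->] := LJ_sum m; rewrite [t *: _]raddf_sum raddf_sum sum_ffunE.
under [RHS]eq_bigr => u _ do
  rewrite (raddf_sum (@eval_pairing k E R X)) sum_ffunE mulr_sumr.
rewrite exchange_big; apply: eq_bigr => p _ /=.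
rewrite [t *: _]fund_rscale_tens eval_pairing_tens ffunE.
have -> : act_by (delta k r) p.1 (fund_ract sGR t p.2) =
    fund_ract sGR t (act_by (delta k r) p.1 p.2).
  exact/esym/(fund_ractZ sGR t).
rewrite /coef [LHS]ffunE exchange_big /=; apply: eq_bigr => u _.
rewrite eval_pairing_tens -{2}[sgval u]invgK -coef_act_by.
rewrite /coef -(sum_deltal (sgval u)^-1%g (act_by (delta k r) p.1 p.2)) mulr_sumr.
apply: eq_bigr => a _; rewrite -mulrA mulrC -mulrA; congr (_ * (_ * _)).
rewrite !ffunE; congr (_%:R); congr nat_of_bool.
by rewrite /Defs.pcomp -(inj_eq (mulgI (sgval u)) a) mulgV eq_sym.
Qed.

End RightAction.

(** * The action of automorphisms on profiles *)

Section AutAction.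
Variables (E : finType) (R : order_on E) (X : finType).
Implicit Types (t : {perm E}) (A B : {set E}).

Lemma mem_imset_perm t B e : (e \in t @: B) = (t^-1%g e \in B).
Proof. by rewrite -{1}[e](permKV t) mem_imset //; apply: perm_inj. Qed.

Section Transport.
Variable t : {perm E}.
Hypothesis tR : t \in Aut_order R.

Let tRE e f : ((t^-1 e)%g, f) \in (R : corr E E) = ((e, t f) \in (R : corr E E)).
Proof. by have /Aut_orderP/(_ (t^-1%g e) f) := tR; rewrite permKV => ->. Qed.

Let tRE' e f : (e, (t^-1 f)%g) \in (R : corr E E) = ((t e, f) \in (R : corr E E)).
Proof. by have /Aut_orderP/(_ e (t^-1%g f)) := tR; rewrite permKV => ->. Qed.

Lemma lb_imset A : lb R (t @: A) = t @: lb R A.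
Proof.
apply/setP=> f; rewrite mem_imset_perm; apply/lbP/lbP => H a aA.
  by rewrite tRE; apply: H; apply: imset_f.
by move: aA; rewrite mem_imset_perm => /H; rewrite tRE permKV.
Qed.

Lemma ub_imset B : ub R (t @: B) = t @: ub R B.
Proof.
apply/setP=> f; rewrite mem_imset_perm; apply/ubP/ubP => H b bB.
  by rewrite tRE'; apply: H; apply: imset_f.
by move: bB; rewrite mem_imset_perm => /H; rewrite tRE' permKV.
Qed.

Lemma dn_imset e : dn R (t e) = t @: dn R e.
Proof. by rewrite -!lb1 -lb_imset imset_set1. Qed.

Lemma sdn_imset e : sdn R (t e) = t @: sdn R e.
Proof.
apply/setP=> f; rewrite mem_imset_perm !in_setD1 dn_imset mem_imset_perm.
by rewrite (can2_eq (permKV t) (permK t)).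
Qed.

Lemma closedb_imset B : closedb R (t @: B) = closedb R B.
Proof.
by rewrite /closedb ub_imset lb_imset (inj_eq (imset_inj (@perm_inj _ t))).
Qed.

Lemma lb_nomin_imset B : lb_nomin R B -> lb_nomin R (t @: B).
Proof.
case/existsP=> A /andP[/eqP <- dis]; apply/existsP; exists (t @: A).
by rewrite lb_imset eqxx imset_disjoint //; apply: perm_inj.
Qed.

Lemma reach_imset e : reach R e -> reach R (t e).
Proof.
elim=> [{}e /lb_nomin_imset|{}e f _ IH ef].
  by rewrite -dn_imset; apply: Reach0.
by apply: ReachS IH _; rewrite sdn_imset ef dn_imset.
Qed.

Lemma free_lb_imset B : free_lb R B -> free_lb R (t @: B).
Proof.
case/orP=> [/andP[cl /forallP np]|/asboolP[e [-> re ncl]]]; apply/orP; [left|right].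
  rewrite /nonprincipal closedb_imset cl; apply/forallP=> e /=.
  by rewrite -[e](permKV t) dn_imset (inj_eq (imset_inj (@perm_inj _ t))).
apply/asboolP; exists (t e); rewrite dn_imset; split=> //.
  exact: reach_imset.
by rewrite sdn_imset closedb_imset.
Qed.

End Transport.

Definition profile_act (g : {ffun X -> E + {set E}}) t :
    {ffun X -> E + {set E}} :=
  [ffun x => match g x with inl e => inl (t e) | inr B => inr (t @: B) end].

Lemma profile_act_inl g t x e :
  (profile_act g t x == inl (t e)) = (g x == inl e).
Proof.
rewrite ffunE; case: (g x) => [f|B] //.
by apply/eqP/eqP => [[/perm_inj ->]|[->]].
Qed.

Lemma profile_act1 g : profile_act g 1 = g.
Proof.
apply/ffunP=> x; rewrite ffunE; case: (g x) => [e|B]; first by rewrite perm1.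
by congr inr; apply/setP=> e; rewrite mem_imset_perm invg1 perm1.
Qed.

Lemma profile_actM g : act_morph profile_act g.
Proof.
move=> s t; apply/ffunP=> x; rewrite !ffunE; case: (g x) => [e|B].
  by rewrite permM.
congr inr; apply/setP=> e; rewrite !mem_imset_perm invMg permM.
by [].
Qed.

Canonical profile_action := TotalAction profile_act1 profile_actM.

Lemma bound_act g t x : t \in Aut_order R ->
  bound R (profile_act g t x) = t @: bound R (g x).
Proof. by move=> tR; rewrite ffunE; case: (g x) => [e|B] //=; apply: dn_imset. Qed.

Lemma hits_act g t (rho : X -> {set E}) : t \in Aut_order R ->
  hits R (profile_act g t) (fun x => t @: rho x) = hits R g rho.
Proof.
move=> tR; apply/hitsP/hitsP => -[H1 H2]; split=> [x|e].
- have := H1 x; rewrite bound_act // => /(imsetS t^-1%g).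
  by rewrite -!imset_comp !(eq_imset _ (permK t : (t^-1)%g \o t =1 id)) !imset_id.
- have [x /eqP] := H2 (t e); rewrite profile_act_inl mem_imset_perm permK => /eqP.
  by exists x.
- by rewrite bound_act // imsetS.
have [x gx ex] := H2 (t^-1%g e); exists x; last by rewrite mem_imset_perm.
by apply/eqP; rewrite -[e](permKV t) profile_act_inl gx.
Qed.

Lemma admissible_act g t : t \in Aut_order R ->
  admissible R g -> admissible R (profile_act g t).
Proof.
move=> tR /admissibleP[H1 H2]; apply/admissibleP; split=> [x B|e].
  rewrite ffunE; case gx: (g x) => [//|B'] [<-].
  by apply: free_lb_imset => //; apply: H1 gx.
have [x gx] := H2 (t^-1%g e); exists x; apply/eqP.
by rewrite -[e](permKV t) profile_act_inl gx.
Qed.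

Lemma profile_act_free g t : admissible R g -> profile_act g t = g -> t = 1%g.
Proof.
move=> /admissibleP[_ H] gt; apply/permP=> e; rewrite perm1.
have [x gx] := H e; have := congr1 (fun h : {ffun X -> _} => h x) gt.
by rewrite ffunE gx => -[].
Qed.

Lemma corr_row_perm t (r : corr E X) x :
  corr_row (corr_comp (corr_perm t) r) x = t @: corr_row r x.
Proof.
apply/setP=> e; rewrite mem_imset_perm !mem_corr_row.
apply/in_corr_comp/idP => [[y /imsetP[f _ [-> ->]]]|ex]; first by rewrite permK.
exists (t^-1%g e) => //; apply/imsetP; exists (t^-1%g e) => //.
by rewrite permKV.
Qed.

(** Translating profile and rows together by [t] changes nothing, so [t] on the argument amounts to
    its inverse on the profile. *)
Lemma vec_act (k : comPzRingType) g t r : t \in Aut_order R ->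
  vec k R (profile_act g t^-1) r = vec k R g (corr_comp (corr_perm t) r).
Proof.
move=> tR; rewrite !ffunE; congr (_%:R); congr nat_of_bool.
rewrite -(@hits_act _ t _ tR) -profile_actM mulVg profile_act1.
by congr (hits R g _); apply: funext => x; rewrite corr_row_perm.
Qed.

End AutAction.

(** * From a freely permuted basis over [k] to a basis over the group algebra *)

Section PermutationBasis.
Variables (k : comPzRingType) (E : finType) (G : {group {perm E}}).
Variables (M : lmodType (GRing.converse (kgroup_alg k G))).
Variables (J : finType) (to : {action {perm E} &-> J}) (S : {set J}) (b : J -> M).

(** As [M] is only given over the group algebra, a scalar [c] of [k] acts on it as [kterm c 1%g]. *)
Definition kterm (c : k) (u : subg_of G) : kgroup_alg k G :=
  [ffun v => c * (v == u)%:R].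

Lemma kterm_sum (x : kgroup_alg k G) :
  x = \sum_u kterm ((x : {ffun _ -> k}) u) u.
Proof.
apply/ffunP=> v; rewrite sum_ffunE (bigD1 v) //= big1 ?addr0 => [|u nu].
  by rewrite ffunE eqxx mulr1.
by rewrite ffunE eq_sym (negPf nu) mulr0.
Qed.

Hypothesis actS : forall j u, j \in S -> u \in G -> to j u \in S.
Hypothesis freeS : forall j u, j \in S -> u \in G -> to j u = j -> u = 1%g.
Hypothesis b_act : forall c j u, j \in S ->
  (kterm c u : (kgroup_alg k G)^c) *: b j =
  (kterm c 1%g : (kgroup_alg k G)^c) *: b (to j (sgval u)^-1%g).
Hypothesis b_span : forall m, exists c : J -> k,
  m = \sum_(j in S) (kterm (c j) 1%g : (kgroup_alg k G)^c) *: b j.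
Hypothesis b_indep : forall c : J -> k,
  \sum_(j in S) (kterm (c j) 1%g : (kgroup_alg k G)^c) *: b j = 0 ->
  forall j, j \in S -> c j = 0.

(** The choice depends only on the orbit as a set; the default [j] never occurs, since an orbit is
    nonempty. *)
Definition orbit_rep j : J := odflt j [pick i in orbit to G j].

Lemma orbit_rep_in j : orbit_rep j \in orbit to G j.
Proof.
by rewrite /orbit_rep; case: pickP => //= /(_ j); rewrite orbit_refl.
Qed.

Lemma orbit_rep_eq i j : i \in orbit to G j -> orbit_rep i = orbit_rep j.
Proof.
move=> ij; have eq_o : orbit to G i = orbit to G j by apply/orbit_eqP.
rewrite /orbit_rep eq_o; case: pickP => //= /(_ j).
by rewrite orbit_refl.
Qed.

Lemma actS_inv j (u : subg_of G) : j \in S -> to j (sgval u)^-1%g \in S.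
Proof. by move=> jS; apply: actS; rewrite // groupV subgP. Qed.

Lemma orbit_rep_act j (u : subg_of G) :
  orbit_rep (to j (sgval u)^-1%g) = orbit_rep j.
Proof. by apply/orbit_rep_eq/mem_orbit; rewrite groupV subgP. Qed.

Lemma orbit_rep_factor j :
  exists u : subg_of G, to (orbit_rep j) (sgval u)^-1%g = j.
Proof.
have /orbitP[u uG uj] : j \in orbit to G (orbit_rep j).
  by rewrite orbit_sym orbit_rep_in.
by exists (subg G u^-1%g); rewrite subgK ?groupV // invgK.
Qed.

Lemma act_inj i (u v : subg_of G) : i \in S ->
  to i (sgval u)^-1%g = to i (sgval v)^-1%g -> u = v.
Proof.
move=> iS uv; apply: val_inj; apply: invg_inj; apply/eqP.
rewrite eq_mulgV1; apply/eqP; apply: (freeS iS).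
  by rewrite invgK groupM ?groupV ?subgP.
by rewrite actM uv invgK actKV.
Qed.

(** By freeness the group parametrises each orbit in [S] bijectively. *)
Lemma sum_orbits (V : zmodType) (F : J -> V) :
  \sum_(j in S) F j =
  \sum_(i in S | orbit_rep i == i) \sum_(u : subg_of G) F (to i (sgval u)^-1%g).
Proof.
rewrite (partition_big orbit_rep (fun i => (i \in S) && (orbit_rep i == i))) /=.
  apply: eq_bigr => i /andP[iS /eqP ri].
  transitivity (\sum_(j in [set to i (sgval u)^-1%g | u in [set: subg_of G]]) F j).
    apply: eq_bigl => j; apply/andP/imsetP => [[jS /eqP rj]|[u _ ->]].
      by have [u uj] := orbit_rep_factor j; exists u; rewrite // -rj uj.
    by rewrite actS_inv // orbit_rep_act ri.
  rewrite big_imset /=; first by apply: eq_bigl => u; rewrite inE.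
  by move=> u v _ _; apply: act_inj.
move=> j jS; have /orbitP[u uG uj] := orbit_rep_in j.
rewrite -{1}uj actS //=; apply/eqP/orbit_rep_eq; exact: orbit_rep_in.
Qed.

Lemma scale_orbit (x : kgroup_alg k G) i : i \in S ->
  (x : (kgroup_alg k G)^c) *: b i =
  \sum_(u : subg_of G)
    (kterm ((x : {ffun _ -> k}) u) 1%g : (kgroup_alg k G)^c) *:
      b (to i (sgval u)^-1%g).
Proof.
move=> iS; rewrite {1}(kterm_sum x) scaler_suml.
by apply: eq_bigr => u _; apply: b_act.
Qed.

(** The basis consists of the orbit representatives in [S]: a group algebra coefficient at a
    representative carries the same data as scalars along its orbit. *)
Lemma free_module_permutation_basis : free_module M.
Proof.
pose P := [pred i | (i \in S) && (orbit_rep i == i)]; pose T := {i in P}.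
have TS (i : T) : val i \in S by have /andP[] := valP i.
have sumT (V : zmodType) (F : J -> V) :
    \sum_(i in S | orbit_rep i == i) F i = \sum_(i : T) F (val i).
  exact: (big_sub P F).
exists T, (fun i : T => b (val i)); split=> [m|s c uniq_s eq0 i0 i0s].
  have [c ->] := b_span m; exists (enum {: T}).
  exists (fun i : T => [ffun u : subg_of G => c (to (val i) (sgval u)^-1%g)]).
  rewrite big_enum sum_orbits sumT; apply: eq_bigr => i _.
  by rewrite scale_orbit //; apply: eq_bigr => u _; rewrite ffunE.
(* The coefficients are extended by zero off [s], and [d] spreads them along the orbits to give a
   relation among the [b j]; the [u] that [d] picks is unique by freeness. *)
pose x (j : J) : kgroup_alg k G :=
  if insub j is Some i then if (i : T) \in s then c i else 0 else 0.
have xE (i : T) : x (val i) = if i \in s then c i else 0 by rewrite /x valK.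
pose d j := if [pick u : subg_of G | to (orbit_rep j) (sgval u)^-1%g == j]
  is Some u then (x (orbit_rep j) : {ffun _ -> k}) u else 0.
have dE (i : T) u : d (to (val i) (sgval u)^-1%g) = (x (val i) : {ffun _ -> k}) u.
  have /andP[iS /eqP ri] := valP i.
  rewrite /d orbit_rep_act ri; case: pickP => [v /eqP/(act_inj iS) -> //|/(_ u)].
  by rewrite eqxx.
have d0 : forall j, j \in S -> d j = 0.
  apply: b_indep; rewrite sum_orbits sumT.
  transitivity (\sum_(i in s) (c i : (kgroup_alg k G)^c) *: b (val i)).
    rewrite [RHS]big_mkcond; apply: eq_bigr => i _.
    under eq_bigr => u _ do rewrite dE.
    by rewrite -scale_orbit // xE; case: ifP; rewrite // scale0r.
  by rewrite -big_uniq.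
have := xE i0; rewrite i0s => <-; apply/ffunP=> u.
by rewrite -dE d0 ?ffunE // actS_inv.
Qed.

End PermutationBasis.

(** * Freeness of the evaluation *)

Section Freeness.
Variables (k : comPzRingType) (E : finType) (R : order_on E) (X : finType).
Variables (G : {group {perm E}}) (sGR : G \subset Aut_order R).
Local Notation psi := (@eval_pairing k E R X).

(** The element [b g] is a preimage of [vec g]. As [psi] is injective, equivariance, spanning and
    independence are checked on functions, by [vec_act], [psi_span] and [vec_indep]. *)
Lemma fund_rmod_free : free_module (fund_rmod k R sGR X).
Proof.
pose S := [set g : {ffun X -> E + {set E}} | admissible R g].
have GR u : u \in G -> u \in Aut_order R by apply/subsetP.
have /fin_all_exists[b bE] (g : {ffun X -> E + {set E}}) :
    exists m : fund_rmod k R sGR X, g \in S -> psi m = vec k R g.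
  have [adm|nadm] := boolP (g \in S); last by exists 0.
  have gv : inr_values (free_or_reach R) g.
    have /admissibleP[H _] : admissible R g by rewrite inE in adm.
    move=> x B /H /orP[np|/asboolP[e [Be re _]]]; first by left.
    by right; exists e.
  by have [m Hm] := psi_vec k gv; exists m.
have psi_kterm (c : k) (u : subg_of G) (m : fund_rmod k R sGR X) r :
    psi ((kterm c u : (kgroup_alg k G)^c) *: m) r =
    c * psi m (corr_comp (corr_perm (sgval u)) r).
  rewrite eval_pairing_rscale (bigD1 u) //= big1 ?addr0 => [|v nv].
    by rewrite ffunE eqxx mulr1.
  by rewrite ffunE (negPf nv) mulr0 mul0r.
have psi_k1 c (m : fund_rmod k R sGR X) r :
    psi ((kterm c 1%g : (kgroup_alg k G)^c) *: m) r = c * psi m r.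
  rewrite psi_kterm; congr (_ * psi m _).
  apply/setP=> -[e x]; rewrite -!mem_corr_row corr_row_perm mem_imset_perm.
  by rewrite invg1 perm1.
have psi_sum (c : {ffun X -> E + {set E}} -> k) r :
    psi (\sum_(g in S) (kterm (c g) 1%g : (kgroup_alg k G)^c) *: b g) r =
    \sum_(g | admissible R g) c g * vec k R g r.
  rewrite (raddf_sum psi) sum_ffunE; apply: eq_big => [g|g gS]; first by rewrite inE.
  by rewrite psi_k1 bE.
apply: (@free_module_permutation_basis k E G _ _ (profile_action E X) S b).
- by move=> g u; rewrite !inE => adm /GR uR; apply: admissible_act.
- by move=> g u; rewrite inE => adm _; apply: profile_act_free adm.
- move=> c g u gS; apply: (@eval_pairing_inj k E R X); apply/ffunP=> r.
  have uR : sgval u \in Aut_order R by apply/GR/subgP.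
  rewrite psi_kterm psi_k1 !bE ?vec_act //.
  by move: gS; rewrite !inE; apply: admissible_act; rewrite groupV.
- move=> m; have [c Hc] := psi_span m; exists c.
  by apply: (@eval_pairing_inj k E R X); apply/ffunP=> r; rewrite psi_sum Hc.
move=> c H g; rewrite inE; apply: (vec_indep (k := k) (R := R)) => r.
by rewrite -psi_sum H raddf0 ffunE.
Qed.

End Freeness.

Theorem theorem6p6 (k : comPzRingType) (E : finType) (R : order_on E)
    (d : Order.disp_t) (T : finTBLatticeType d) (iota : E -> T)
    (hIrr : is_Irr R iota)
    (hAut : isom (Aut_lattice T) (Aut_order R) (Aut_restr iota))
    (X : finType) :
  free_module (B := GRing.converse (kgroup_alg k (Aut_order_group R)))
    (fund_rmod k (opp_order R) (Aut_order_sub_opp R) X).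
Proof. exact: fund_rmod_free. Qed.
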